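(* Let $X$ be an infinite dimensional complex Banach space and let $T\in L(X)$. Then $T$ is a B-Fredholm operator if and only if $T=T_1\oplus T_2$ such that $T_1$ is Fredholm and semi-regular and $T_2$ is nilpotent. Moreover, in this case $T$ is pseudo B-Fredholm and $\alpha(T)=\alpha(T_1)$, $\beta(T)=\beta(T_1)$, $p(T)=p(T_1)$, $q(T)=q(T_1)$ and $\mathrm{ind}(T)=\mathrm{ind}(T_1)=\mathrm{ind}(T_{[n]})$, where $n$ is any integer such that $\mathcal R(T^n)$ is closed and $T_{[n]}$ is semi-Fredholm, and $\mathrm{ind}(T)$ is the index of $T$ as a pseudo B-Fredholm operator.
   Context: For a bounded operator $S$ on a Banach space $Y$, with kernel $\mathcal N(S)$ and range $\mathcal R(S)$: $S$ is upper semi-Fredholm if $\mathcal R(S)$ is closed and $\dim\mathcal N(S)<\infty$; lower semi-Fredholm if $\mathrm{codim}\,\mathcal R(S)<\infty$; semi-Fredholm if it is upper or lower semi-Fredholm, and then $\mathrm{ind}(S)=\dim\mathcal N(S)-\mathrm{codim}\,\mathcal R(S)\in\mathbb Z\cup\{\pm\infty\}$; Fredholm if it is semi-Fredholm with integer index. $S$ is semi-regular if $\mathcal R(S)$ is closed and $\mathcal N(S)\subset\bigcap_{k\in\mathbb N}\mathcal R(S^k)$. $S$ is quasi-nilpotent if $0$ is the only point of its spectrum. $L(X)$ is the algebra of bounded operators on $X$. For $n\in\mathbb N$ (including $0$), $T_{[n]}:\mathcal R(T^n)\to\mathcal R(T^n)$ is the restriction of $T$. $T$ is B-Fredholm if for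 some integer $n\ge0$ the range $\mathcal R(T^n)$ is closed and $T_{[n]}$ is Fredholm. $(M,N)\in Red(T)$ means that $M,N$ are closed $T$-invariant subspaces with $X=M\oplus N$ (so $M\cap N=\{0\}$); $T_M$ denotes the restriction of $T$ to $M$. Writing $T=T_1\oplus T_2$ means that there is $(M,N)\in Red(T)$ with $T_1=T_M$, $T_2=T_N$. The zero subspace is allowed; the operator on $\{0\}$ is regarded as nilpotent, quasi-nilpotent, semi-regular and Fredholm of index $0$. $T$ is pseudo B-Fredholm if there exists $(M,N)\in Red(T)$ such that $T_M$ is Fredholm and $T_N$ is quasi-nilpotent; its index as a pseudo B-Fredholm operator is $\mathrm{ind}(T):=\mathrm{ind}(T_M)$, independent of the choice of such $(M,N)$. An operator $S$ is pseudo-Fredholm if there exists $(M,N)\in Red(S)$ with $S_M$ semi-regular and $S_N$ quasi-nilpotent (every pseudo B-Fredholm operator is pseudo-Fredholm). For a pseudo-Fredholm $S$ and any such $(M,N)$, one defines $\alpha(S):=\dim\mathcal N(S_M)$, $\beta(S):=\dim(M/\mathcal R(S_M))$, $p(S):=\inf\{k\in\mathbb N:\mathcal N(S_M^k)=\mathcal N(S_M^m)\ \forall m\ge k\}$, $q(S):=\inf\{k\in\mathbb N:\mathcal R(S_M^k)=\mathcal R(S_M^m)\ \forall m\ge k\}$ (with $\inf\emptyset=\infty$); these do not depend on the choice of $(M,N)$. For semi-regular $S$ they are the usual nullity, deficiency, ascent and descent of $S$. *)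

(* Defs.v *)
From HB Require Import structures.
From mathcomp Require Import all_boot all_order all_algebra.
From mathcomp Require Import complex.
From mathcomp Require Import all_classical all_reals all_analysis.

Set Implicit Arguments.
Unset Strict Implicit.
Unset Printing Implicit Defensive.

Import Order.TTheory GRing.Theory Num.Theory.
Import numFieldNormedType.Exports.
Local Open Scope classical_set_scope.
Local Open Scope ring_scope.

(* Complex scalars are R[i] with R : realType. Elements of
   N U {oo} and Z U {-oo, oo} are represented by their images in \bar R.

   An operator on a Banach space Y is represented by a pair (T, Y): T is a map
   on an ambient Banach space X, Y is a T-invariant linear subspace of X, and
   (T, Y) stands for the restriction T_Y : Y -> Y. The whole space is Y = setT.
   The notions below are meant for closed Y; a subset of such a Y is closed in
   Y iff it is closed in X, so ranges are asked to be closed in X. *)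

(* inf of a set of naturals, with value +oo on the empty set *)
Definition inf_nat (R : realType) (P : set nat) : \bar R :=
  ereal_inf [set (k%:R : R)%:E | k in P].

Section Operators.
Variables (R : realType) (X : completeNormedModType R[i]).
Implicit Types (T : X -> X) (V W Y M N : set X).

Definition subspace_set Y : Prop :=
  Y 0 /\ forall (a : R[i]) (x y : X), Y x -> Y y -> Y (a *: x + y).

(* e induces a basis of the quotient vector space V / W (for W included in V) *)
Definition quot_basis V W (n : nat) (e : 'I_n -> X) : Prop :=
  [/\ forall i, V (e i),
      forall c : 'I_n -> R[i],
        W (\sum_(i < n) c i *: e i) -> forall i, c i = 0
    & forall x, V x ->
        exists c : 'I_n -> R[i], W (x - \sum_(i < n) c i *: e i)].

(* dim (V / W), equal to +oo when V / W has no finite basis *)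
Definition qdim V W : \bar R :=
  inf_nat R [set n | exists e : 'I_n -> X, quot_basis V W e].

Definition vdim V : \bar R := qdim V [set 0].

Definition ker_on T Y : set X := [set x | Y x /\ T x = 0].

Definition nullity T Y : \bar R := vdim (ker_on T Y).
Definition deficiency T Y : \bar R := qdim Y (T @` Y).

Definition ascent T Y : \bar R :=
  inf_nat R [set k | forall m, (k <= m)%N ->
                       ker_on (iter k T) Y = ker_on (iter m T) Y].
Definition descent T Y : \bar R :=
  inf_nat R [set k | forall m, (k <= m)%N ->
                       iter k T @` Y = iter m T @` Y].

Definition upper_semi_fredholm T Y : Prop :=
  closed (T @` Y) /\ (nullity T Y < +oo)%E.
Definition lower_semi_fredholm T Y : Prop := (deficiency T Y < +oo)%E.
Definition semi_fredholm T Y : Prop :=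
  upper_semi_fredholm T Y \/ lower_semi_fredholm T Y.

(* Only meaningful for semi-Fredholm operators, where oo - oo cannot occur. *)
Definition fred_index T Y : \bar R := (nullity T Y - deficiency T Y)%E.

Definition fredholm T Y : Prop :=
  semi_fredholm T Y /\ fred_index T Y \is a fin_num.

Definition semi_regular T Y : Prop :=
  closed (T @` Y) /\ ker_on T Y `<=` \bigcap_k (iter k T @` Y).

Definition nilpotent_on T Y : Prop :=
  exists n : nat, forall x, Y x -> iter n T x = 0.

(* The restriction of A to Y has an inverse S in L(Y); the values of S outside
   of Y are irrelevant. *)
Definition invertible_on (A : X -> X) Y : Prop :=
  exists S : X -> X,
    [/\ forall x, Y x -> Y (S x),
        forall (a : R[i]) (x y : X), Y x -> Y y ->
          S (a *: x + y) = a *: S x + S y,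
        {within Y, continuous S},
        forall x, Y x -> S (A x) = x
      & forall x, Y x -> A (S x) = x].

Definition spectrum T Y : set R[i] :=
  [set l | ~ invertible_on (fun x => T x - l *: x) Y].

(* The operator on the zero space, whose spectrum is empty, is quasi-nilpotent
   by convention. *)
Definition quasi_nilpotent T Y : Prop :=
  Y = [set 0] \/ spectrum T Y = [set 0].

(* (M, N) \in Red (T_Y) *)
Definition Red T Y M N : Prop :=
  [/\ [/\ closed M, subspace_set M, M `<=` Y & T @` M `<=` M],
      [/\ closed N, subspace_set N, N `<=` Y & T @` N `<=` N],
      M `&` N = [set 0]
    & forall x, Y x -> exists y z, [/\ M y, N z & x = y + z]].

Definition bfredholm T Y : Prop :=
  exists n : nat,
    closed (iter n T @` Y) /\ fredholm T (iter n T @` Y).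

Definition pseudo_bfredholm_pair T Y M N : Prop :=
  [/\ Red T Y M N, fredholm T M & quasi_nilpotent T N].
Definition pseudo_bfredholm T Y : Prop :=
  exists M N, pseudo_bfredholm_pair T Y M N.

Definition pseudo_fredholm_pair T Y M N : Prop :=
  [/\ Red T Y M N, semi_regular T M & quasi_nilpotent T N].

(* The following quantities of T_Y do not depend on the decomposition (M, N);
   [xget] picks the value given by some decomposition. The default value +oo
   is only used when there is no decomposition, where they are undefined. *)
Definition pbf_index T Y : \bar R :=
  xget +oo%E [set fred_index T M | M in
               [set M | exists N, pseudo_bfredholm_pair T Y M N]].

Definition pf_value (f : set X -> \bar R) T Y : \bar R :=
  xget +oo%E [set f M | M in
               [set M | exists N, pseudo_fredholm_pair T Y M N]].

Definition alpha T Y : \bar R := pf_value (nullity T) T Y.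
Definition beta T Y : \bar R := pf_value (deficiency T) T Y.
Definition pf_ascent T Y : \bar R := pf_value (ascent T) T Y.
Definition pf_descent T Y : \bar R := pf_value (descent T) T Y.

End Operators.

(* Main.v *)
Require Import Defs.
From HB Require Import structures.
From mathcomp Require Import all_boot all_order all_algebra.
From mathcomp Require Import complex.
From mathcomp Require Import all_classical all_reals all_analysis.
From mathcomp Require Import lra zify.

Set Implicit Arguments.
Unset Strict Implicit.
Unset Printing Implicit Defensive.

Import Order.TTheory GRing.Theory Num.Theory.
Import numFieldNormedType.Exports.
Local Open Scope classical_set_scope.
Local Open Scope ring_scope.
Local Open Scope complex_scope.

(** Let [T] be B-Fredholm. For large [d] the range [W] of [T ^ d] is closed, [T] is
    Fredholm on [W], and the kernel of [T] on [W] lies in the range of every power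
    of [T], because a decreasing sequence of finite-dimensional spaces is
    stationary ([stationary_kernel]). Both summands are built from [W].

    The semi-regular summand [M] is reached from [W] in [d] steps, each of which
    adjoins preimages under [T] of a basis of the current space modulo its image
    ([extension_step], [semi_regular_part]). Only finitely many vectors are added,
    so that [M] is closed; no new kernel vectors appear, and [T ^ d] maps [M] onto
    [W]. Hence every vector is the sum of a vector of [M] and of one of the kernel
    of [T ^ d], and it remains to find in this kernel an invariant complement of
    its intersection with [M] ([nilpotent_complement]). As a module over the
    polynomials in [T] truncated at degree [d], that intersection is free; a
    continuous projection onto the finite-dimensional kernel of [T] on [M], given
    by the Hahn-Banach theorem, therefore determines the complement.

    Conversely, let [T] be Fredholm and semi-regular on [M] and nilpotent of order
    [d] on [N]. Then [T ^ d] has the same range as its restriction to [M]. This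
    range is closed by the open mapping theorem, and the index of [T] on it is the
    index on [M] ([index_iter]): the kernel loses as many dimensions as the
    cokernel when one passes from a space to its image ([index_image]). The same
    computation gives the index on the range of any power of [T] on which [T] is
    semi-Fredholm.

    For the invariants, let [(M', N')] be another reduction, with [T] quasi-nilpotent
    on [N']. The point is that [T] is bijective on [Z = T ^ d N']
    ([quasi_nilpotent_range_bijective]). Indeed [Z] is closed, so is [T Z], and the
    kernel of [T] on [Z] lies in the range of every power of [T] on [Z], as the same
    holds for [T ^ d M], which contains [Z]. A nonzero kernel would then spread to
    approximate eigenvectors for small nonzero scalars ([hyperrange_injective]); so
    [T] is bounded below on [Z], and solving [T x - l x = z] for [l] tending to [0]
    shows that it is onto ([hyperrange_surjective]). Consequently [N'] contributes
    to kernels, ranges and indices no more than [N] does: the kernels of [T ^ k] on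
    [M] and [M'] coincide when [T] is semi-regular on [M'] ([ker_iter_unique]), so do
    the spaces [T M + N] and [T M' + N'] ([range_sum_unique]), and the indices on [M]
    and [M'] coincide when [T] is Fredholm on [M']
    ([index_decomposition_unique]). *)

(** * The real-valued norm of a complex normed module *)

Section RealNorm.
Variables (R : realType) (X : completeNormedModType R[i]).
Implicit Types (x y : X) (A : set X) (r : R).

(** The norm takes its values in [R[i]], whose order is partial; its real part
    carries the same information and turns estimates into inequalities between
    reals. *)
Definition nrm x : R := complex.Re `|x|.

Lemma nrmE x : `|x| = (nrm x)%:C.
Proof. by rewrite /nrm RRe_real// normr_real. Qed.

Lemma nrm_ge0 x : 0 <= nrm x.
Proof. by rewrite -ler0c -nrmE. Qed.

Lemma nrm0 : nrm 0 = 0.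
Proof. by rewrite /nrm normr0. Qed.

Lemma nrm_eq0 x : nrm x = 0 -> x = 0.
Proof. by move=> x0; apply/normr0_eq0; rewrite nrmE x0. Qed.

Lemma nrmN x : nrm (- x) = nrm x.
Proof. by rewrite /nrm normrN. Qed.

Lemma nrmB x y : nrm (x - y) = nrm (y - x).
Proof. by rewrite -nrmN opprB. Qed.

Lemma nrmD x y : nrm (x + y) <= nrm x + nrm y.
Proof. by rewrite -lecR rmorphD /= -!nrmE ler_normD. Qed.

Lemma nrmZ (a : R[i]) x : nrm (a *: x) = complex.Re `|a| * nrm x.
Proof.
apply: complexI; rewrite rmorphM /= -!nrmE normrZ.
by congr (_ * _).
Qed.

Lemma nrmZr r x : nrm (r%:C *: x) = `|r| * nrm x.
Proof. by rewrite nrmZ normc_def /= expr0n/= addr0 sqrtr_sqr. Qed.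

Lemma complexr_neq0 r : 0 < r -> r%:C != 0.
Proof. by move=> r0; rewrite eq_complex /= negb_and gt_eqF. Qed.

Lemma gt0_complexP (e : R[i]) : 0 < e -> exists2 r : R, 0 < r & e = r%:C.
Proof.
move=> e0; have /complex_realP[r er] : e \is Num.real by exact: gtr0_real.
by exists r => //; rewrite -ltcR -er.
Qed.

Lemma nbhs_nrmP x A :
  nbhs x A <-> exists2 e : R, 0 < e & forall y, nrm (x - y) < e -> A y.
Proof.
split=> [/nbhs_normP[e /= e0 eA]|[e e0 eA]].
  have [r r0 er] := gt0_complexP e0.
  by exists r => // y xy; apply: eA; rewrite /= nrmE er ltcR.
apply/nbhs_normP; exists e%:C => /=; first by rewrite ltcR.
by move=> y /=; rewrite nrmE ltcR; exact: eA.
Qed.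

Lemma closed_nrmP A :
  closed A <-> forall x,
    (forall e : R, 0 < e -> exists2 a, A a & nrm (x - a) < e) -> A x.
Proof.
split=> cA x xA.
  apply: cA => B /nbhs_nrmP[e e0 eB].
  by have [a Aa xa] := xA _ e0; exists a; split => //; exact: eB.
apply: cA => e e0; have [|a [Aa xa]] := xA [set y | nrm (x - y) < e].
  by apply/nbhs_nrmP; exists e.
by exists a.
Qed.

Lemma geometric_small (c e : R) : 0 <= c -> 0 < e -> exists n, c * 2^-1 ^+ n < e.
Proof.
move=> c0 e0; have ce0 : 0 <= c / e by rewrite divr_ge0// ltW.
exists (Num.bound (c / e)); rewrite exprVn ltr_pdivrMr ?exprn_gt0//.
rewrite -ltr_pdivrMl// mulrC (lt_le_trans (archi_boundP ce0))//.
by rewrite -natrX ler_nat ltnW// ltn_expl.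
Qed.

Lemma ler_geometric (a b c : R) :
  0 <= c -> (forall n, a <= b + c * 2^-1 ^+ n) -> a <= b.
Proof.
move=> c0 H; apply/ler_addgt0Pr => e /(geometric_small c0)[n ne].
by rewrite (le_trans (H n))// lerD2l ltW.
Qed.

(** Completeness in the only form used below: a geometric bound on the
    increments yields a limit together with the rate of convergence. *)
Lemma geometric_cvg (u : nat -> X) (c : R) :
  (forall n, nrm (u n.+1 - u n) <= c * 2^-1 ^+ n) ->
  exists l, forall n, nrm (l - u n) <= 2 * c * 2^-1 ^+ n.
Proof.
move=> uc.
have c0 : 0 <= c by have := uc 0; rewrite expr0 mulr1; apply/le_trans/nrm_ge0.
have h0 : 0 < 2^-1 :> R by rewrite invr_gt0.
have key n k :
    nrm (u (n + k)%N - u n) <= 2 * c * 2^-1 ^+ n - 2 * c * 2^-1 ^+ (n + k).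
  elim: k => [|k IH]; first by rewrite addn0 !subrr nrm0.
  rewrite addnS -(subrKA (u (n + k)%N)) (le_trans (nrmD _ _))//.
  have := uc (n + k)%N; rewrite exprS.
  set a := 2^-1 ^+ (n + k) in IH *; move: IH.
  set N1 := nrm _; set N2 := nrm _; set b := 2^-1 ^+ n.
  have -> : 2 * c * (2^-1 * a) = c * a by rewrite mulrACA mulfV// mul1r.
  by lra.
have {}key n m : (n <= m)%N -> nrm (u m - u n) <= 2 * c * 2^-1 ^+ n.
  move=> nm; rewrite -(subnKC nm) (le_trans (key _ _))// gerBl.
  by rewrite !mulr_ge0// exprn_ge0// ltW.
have /cvg_ex[l ul] : cvg (u @ \oo).
  apply: cauchy_cvg; apply: cauchy_exP => e /gt0_complexP[r r0 ->].
  have [n nr] := geometric_small (mulr_ge0 (ler0n _ 2) c0) r0.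
  exists (u n); exists n => // m /= nm.
  by rewrite -ball_normE /= nrmE ltcR nrmB (le_lt_trans (key _ _ nm)).
exists l => n; apply/ler_addgt0Pr => e e0.
have : nbhs l [set y | nrm (l - y) < e] by apply/nbhs_nrmP; exists e.
move=> /ul[m _ /(_ (maxn m n))]; rewrite /= leq_maxl => /(_ isT) lm.
rewrite -(subrKA (u (maxn m n))) (le_trans (nrmD _ _))// addrC lerD//; last exact: ltW.
by apply: key; rewrite leq_maxr.
Qed.

Lemma closed_geometric A (u : nat -> X) l (c : R) :
  closed A -> (forall n, A (u n)) -> 0 <= c ->
  (forall n, nrm (l - u n) <= c * 2^-1 ^+ n) -> A l.
Proof.
move=> /closed_nrmP cA Au c0 lu; apply: cA => e /(geometric_small c0)[n ne].
by exists (u n) => //; exact: le_lt_trans ne.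
Qed.

Lemma continuous_nrmP (f : {linear X -> X}) :
  continuous f <-> exists2 C : R, 0 < C & forall x, nrm (f x) <= C * nrm x.
Proof.
split=> [cf|[C C0 fC] x A /nbhs_nrmP[e e0 eA]].
  have /nbhs_nrmP[e e0 ef] : nbhs (0 : X) (f @^-1` [set y | nrm y < 1]).
    apply: cf; rewrite linear0; apply/nbhs_nrmP; exists 1 => // y /=.
    by rewrite sub0r nrmN.
  exists (2 / e); first by rewrite divr_gt0.
  move=> x; have [x0|x0] := eqVneq (nrm x) 0.
    by move/nrm_eq0: x0 => ->; rewrite linear0 nrm0 mulr0.
  have {}x0 : 0 < nrm x by rewrite lt_def x0 nrm_ge0.
  have d0 : 0 < e / 2 / nrm x by rewrite !divr_gt0.
  have := ef ((e / 2 / nrm x)%:C *: x).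
  rewrite sub0r nrmN nrmZr gtr0_norm// divfK ?gt_eqF// /= linearZ/= nrmZr.
  have e2 : e / 2 < e by rewrite ltr_pdivrMr//; lra.
  rewrite gtr0_norm// => /(_ e2); rewrite -ltr_pdivlMl// mulr1 => fx; apply/ltW.
  have -> : 2 / e * nrm x = (e / 2 / nrm x)^-1 by rewrite !invfM !invrK (mulrC 2).
  exact: fx.
apply/nbhs_nrmP; exists (e / C); first by rewrite divr_gt0.
move=> y xy; apply: eA; rewrite -linearB (le_lt_trans (fC _))//.
by rewrite mulrC -ltr_pdivlMr.
Qed.

End RealNorm.

(** * Linear subspaces and the open mapping theorem *)

Section Subspaces.
Variables (R : realType) (X : completeNormedModType R[i]).
Implicit Types (x y z : X) (A B C Y F Z U : set X).

Lemma subspace0 A : subspace_set A -> A 0. Proof. by case. Qed.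

Lemma subspaceD A x y : subspace_set A -> A x -> A y -> A (x + y).
Proof. by move=> [_ h] Ax Ay; rewrite -[x]scale1r; exact: h. Qed.

Lemma subspaceZ A (a : R[i]) x : subspace_set A -> A x -> A (a *: x).
Proof. by move=> [A0 h] Ax; rewrite -[_ *: _]addr0; exact: h. Qed.

Lemma subspaceN A x : subspace_set A -> A x -> A (- x).
Proof. by move=> sA Ax; rewrite -scaleN1r; exact: subspaceZ. Qed.

Lemma subspaceB A x y : subspace_set A -> A x -> A y -> A (x - y).
Proof. by move=> sA Ax Ay; apply: subspaceD => //; exact: subspaceN. Qed.

Lemma subspace_sum A n (F : 'I_n -> X) :
  subspace_set A -> (forall i, A (F i)) -> A (\sum_(i < n) F i).
Proof.
move=> sA AF; elim/big_ind : _ => // [|x y]; [exact: subspace0|exact: subspaceD].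
Qed.

Lemma subspace_setT : subspace_set [set: X]. Proof. by []. Qed.

Lemma subspace_set0 : subspace_set [set (0 : X)].
Proof. by split=> // a x y /= -> ->; rewrite scaler0 addr0. Qed.

Lemma subspace_image (f : {linear X -> X}) A : subspace_set A -> subspace_set (f @` A).
Proof.
move=> [A0 hA]; split; first by exists 0; rewrite ?linear0.
by move=> a _ _ [x Ax <-] [y Ay <-]; exists (a *: x + y); [exact: hA|rewrite linearP].
Qed.

Lemma subspace_ker (f : {linear X -> X}) A : subspace_set A -> subspace_set (ker_on f A).
Proof.
move=> [A0 hA]; split; first by split=> //; rewrite linear0.
move=> a x y [Ax fx] [Ay fy]; split; first exact: hA.
by rewrite linearP fx fy scaler0 addr0.
Qed.

Definition sumset A B : set X := [set x | exists a b, [/\ A a, B b & x = a + b]].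

Lemma subspace_sumset A B :
  subspace_set A -> subspace_set B -> subspace_set (sumset A B).
Proof.
move=> [A0 hA] [B0 hB]; split; first by exists 0, 0; rewrite addr0.
move=> a _ _ [x [x' [Ax Bx ->]]] [y [y' [Ay By ->]]].
exists (a *: x + y), (a *: x' + y'); split; [exact: hA|exact: hB|].
by rewrite scalerDr addrACA.
Qed.

Lemma sumsetl A B : subspace_set B -> A `<=` sumset A B.
Proof. by move=> [B0 _] x Ax; exists x, 0; rewrite addr0. Qed.

Lemma sumsetr A B : subspace_set A -> B `<=` sumset A B.
Proof. by move=> [A0 _] x Bx; exists 0, x; rewrite add0r. Qed.

Lemma closed_set0 : closed [set (0 : X)].
Proof.
apply/closed_nrmP => x x0; apply/nrm_eq0/eqP; rewrite eq_le nrm_ge0 andbT.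
apply/ler_addgt0Pr => e /x0[_ /= ->]; rewrite subr0 add0r; exact: ltW.
Qed.

End Subspaces.

Section OpenMapping.
Variables (R : realType) (X : completeNormedModType R[i]) (T : {linear X -> X}).
Hypothesis contT : continuous T.
Implicit Types (x y z : X) (A B C Y F Z U : set X).

(** The open mapping theorem is stated for the map [(y, f) |-> T y + f] on
    [Y] times [F]: the case [F = 0] is the usual one, and finite-dimensional [F]
    handles ranges of finite codimension without forming product spaces. *)
Section Surjection.
Variables Y F Z : set X.
Hypotheses (cY : closed Y) (sY : subspace_set Y) (cF : closed F)
  (sF : subspace_set F) (cZ : closed Z) (sZ : subspace_set Z)
  (ZE : Z = sumset (T @` Y) F).

Let image_ball (n : nat) : set X :=
  [set z | exists y f, [/\ Y y, F f, z = T y + f, nrm y <= n%:R & nrm f <= n%:R]].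

(** Baire category: the sets [image_ball n] cover the complete space [Z], so
    one of them is dense in some ball of [Z]; otherwise nested balls, the n-th
    of which avoids [image_ball n], would shrink to a point of [Z] that is not
    covered. *)
Lemma image_ball_somewhere_dense : exists (n : nat) (z0 : X) (r : R),
  [/\ Z z0, 0 < r & forall z, Z z -> nrm (z - z0) <= r -> forall e : R, 0 < e ->
     exists2 d, image_ball n d & nrm (z - d) < e].
Proof.
apply: contrapT => nodense.
have step (p : nat * (X * R)) : exists q : X * R, Z p.2.1 -> 0 < p.2.2 ->
    [/\ Z q.1, nrm (q.1 - p.2.1) <= p.2.2 / 2, 0 < q.2, q.2 <= p.2.2 / 2
      & forall d, image_ball p.1 d -> q.2 < nrm (q.1 - d)].
  case: p => n [z0 r] /=; have [Zz0|nZ] := pselect (Z z0); last by exists (0, 0).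
  have [r0|r0] := ltP 0 r; last by exists (0, 0).
  apply: contrapT => noq; apply: nodense; exists n, z0, (r / 2); split=> //.
    by rewrite divr_gt0.
  move=> z Zz zz0 e e0; apply: contrapT => nod; apply: noq.
  exists (z, Num.min (r / 2) (e / 2)) => _ _ /=; split=> //.
  - by rewrite lt_min !divr_gt0.
  - by rewrite ge_min lexx.
  move=> d nd; rewrite gt_min; apply/orP; right; rewrite ltNge; apply/negP => de.
  by apply: nod; exists d => //; lra.
have [g gP] := choice step.
pose s := fix s n := if n is m.+1 then g (m, s m) else (0 : X, 1 : R).
have sP n : Z (s n).1 /\ 0 < (s n).2.
  elim: n => [|n [Zs s0]] /=; first by split => //; exact: subspace0.
  by have [] := gP (n, s n) Zs s0.
have sS n : [/\ nrm ((s n.+1).1 - (s n).1) <= (s n).2 / 2,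
    (s n.+1).2 <= (s n).2 / 2
    & forall d, image_ball n d -> (s n.+1).2 < nrm ((s n.+1).1 - d)].
  by have [Zs s0] := sP n; have [] := gP (n, s n) Zs s0.
have rad n : (s n).2 <= 2^-1 ^+ n.
  elim: n => [|n IH]; first by rewrite expr0.
  have [_ + _] := sS n; rewrite exprS; move: IH; set a := _ ^+ n; lra.
have [|l lP] := @geometric_cvg _ _ (fun n => (s n).1) (2^-1).
  by move=> n; have [+ _ _] := sS n; have := rad n; set a := _ ^+ n; lra.
have near_l n : nrm (l - (s n).1) <= (s n).2.
  apply: (@ler_geometric _ _ _ 1) => // k.
  have dist m : nrm ((s (n + m)%N).1 - (s n).1) <= (s n).2 - (s (n + m)%N).2.
    elim: m => [|m IH]; first by rewrite addn0 !subrr nrm0.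
    rewrite addnS -(subrKA (s (n + m)%N).1) (le_trans (nrmD _ _))//.
    by have [+ + _] := sS (n + m)%N; move: IH => /=; lra.
  rewrite -(subrKA (s (n + k)%N).1) (le_trans (nrmD _ _))//.
  have := dist k; have := lP (n + k)%N; have [_ s0] := sP (n + k)%N.
  have : 2^-1 ^+ (n + k) <= 2^-1 ^+ k :> R.
    by rewrite ler_wiXn2l ?leq_addl// invf_le1// ler1n.
  by set a := _ ^+ (n + k); set b := _ ^+ k; lra.
have Zl : Z l.
  apply: (closed_geometric cZ (fun n => (sP n).1) _ lP).
  by rewrite mulr_ge0.
move: Zl; rewrite ZE => -[_ [f [[y Yy <-] Ff lyf]]].
pose n := Num.bound (Num.max (nrm y) (nrm f)).
have : Num.max (nrm y) (nrm f) < n%:R.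
  by apply: archi_boundP; rewrite le_max nrm_ge0.
rewrite gt_max => /andP[/ltW yn /ltW fn].
have [_ _ /(_ l)] := sS n; rewrite nrmB ltNge near_l => /(_ _)/negP; apply => //.
by exists y, f.
Qed.

(** Translating and rescaling the ball of the previous lemma gives approximate
    preimages with a norm control that is uniform on [Z]. *)
Lemma approximate_preimage : exists2 C : R, 0 < C & forall z, Z z ->
  exists y f, [/\ Y y, F f, nrm (z - (T y + f)) <= nrm z / 2,
                  nrm y <= C * nrm z & nrm f <= C * nrm z].
Proof.
have [n [z0 [r [Zz0 r0 dens]]]] := image_ball_somewhere_dense.
exists (2 * n%:R / r + 1).
  by rewrite ltr_wpDl// divr_ge0// ?mulr_ge0// ltW.
move=> z Zz; have [z_0|z_neq0] := eqVneq (nrm z) 0.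
  exists 0, 0; rewrite linear0 addr0 subr0 z_0 nrm0 !mulr0 mul0r.
  by split => //; exact: subspace0.
have zgt0 : 0 < nrm z by rewrite lt_def z_neq0 nrm_ge0.
pose t := r / nrm z; have t0 : 0 < t by rewrite divr_gt0.
have tz : t * nrm z = r by rewrite /t divfK.
have e0 : 0 < r / 4 by rewrite divr_gt0.
have [||_ [y1 [f1 [Yy1 Ff1 -> ny1 nf1]]] d1] := dens (z0 + t%:C *: z) _ _ _ e0.
- by apply: subspaceD => //; exact: subspaceZ.
- by rewrite addrC addKr nrmZr gtr0_norm// tz.
have [||_ [y2 [f2 [Yy2 Ff2 -> ny2 nf2]]] d2] := dens z0 _ _ _ e0.
- by [].
- by rewrite subrr nrm0 ltW.
have tc0 := complexr_neq0 t0.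
have scal x : nrm x <= 2 * n%:R -> nrm ((t^-1)%:C *: x) <= (2 * n%:R / r + 1) * nrm z.
  move=> xn; rewrite nrmZr gtr0_norm ?invr_gt0// mulrC ler_pdivrMr//.
  rewrite -(mulrA _ (nrm z)) (mulrC (nrm z)) tz mulrDl divfK ?gt_eqF// mul1r.
  by rewrite (le_trans xn)// lerDl ltW.
exists ((t^-1)%:C *: (y1 - y2)), ((t^-1)%:C *: (f1 - f2)); split.
- by apply: subspaceZ => //; exact: subspaceB.
- by apply: subspaceZ => //; exact: subspaceB.
- have -> : z - (T ((t^-1)%:C *: (y1 - y2)) + (t^-1)%:C *: (f1 - f2)) =
      (t^-1)%:C *: ((z0 + t%:C *: z - (T y1 + f1)) - (z0 - (T y2 + f2))).
    rewrite linearZ/= -scalerDr -[in LHS](scalerK tc0 z) fmorphV -scalerBr.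
    congr (_ *: _); rewrite linearB addrACA -opprD.
    move: (T y1 + _) (T y2 + _) => p q; rewrite !opprB [z0 + _]addrC -!addrA; congr (_ + _).
    by rewrite [RHS]addrC -addrA subrK addrC.
  rewrite nrmZr gtr0_norm ?invr_gt0// mulrC ler_pdivrMr//.
  rewrite mulrAC -(mulrC t) tz (le_trans (nrmD _ _))// nrmN.
  by move: d1 d2; lra.
- by apply: scal; rewrite (le_trans (nrmD _ _))// nrmN; lra.
- by apply: scal; rewrite (le_trans (nrmD _ _))// nrmN; lra.
Qed.

(** Successive approximation: the errors of the approximate preimages are halved
    at each stage, so the corrections add up to an exact preimage. *)
Lemma open_mapping : exists2 C : R, 0 < C & forall z, Z z ->
  exists y f, [/\ Y y, F f, z = T y + f, nrm y <= C * nrm z & nrm f <= C * nrm z].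
Proof.
have [C C0 approx] := approximate_preimage.
have [K K0 TK] := (continuous_nrmP T).1 contT.
have step z : exists p : X * X, Z z -> [/\ Y p.1, F p.2,
    nrm (z - (T p.1 + p.2)) <= nrm z / 2, nrm p.1 <= C * nrm z
    & nrm p.2 <= C * nrm z].
  have [/approx[y [f ?]]|nZ] := pselect (Z z); last by exists (0, 0).
  by exists (y, f).
have [g gP] := choice step; exists (2 * C); first by rewrite mulr_gt0.
move=> z Zz.
pose rest (p : X * X) := z - (T p.1 + p.2).
pose s := fix s n := if n is m.+1 then
  ((s m).1 + (g (rest (s m))).1, (s m).2 + (g (rest (s m))).2) else (0 : X, 0 : X).
have restS n : rest (s n.+1) =
    rest (s n) - (T (g (rest (s n))).1 + (g (rest (s n))).2).
  by rewrite {1}/rest /= (linearD T) addrACA opprD addrA.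
have restP n : Z (rest (s n)) /\ nrm (rest (s n)) <= nrm z * 2^-1 ^+ n.
  elim: n => [|n [Zn rn]].
    by rewrite {1 2}/rest /= linear0 addr0 subr0 expr0 mulr1.
  have [Yy Ff small _ _] := gP _ Zn; rewrite restS; split.
    apply: subspaceB => //; rewrite ZE; exists (T (g (rest (s n))).1), (g (rest (s n))).2.
    by split => //; exists (g (rest (s n))).1.
  rewrite (le_trans small)// exprSr mulrA ler_pM2r ?invr_gt0//.
have sP n : [/\ Y (s n).1, F (s n).2,
    nrm ((s n.+1).1 - (s n).1) <= C * nrm z * 2^-1 ^+ n
    & nrm ((s n.+1).2 - (s n).2) <= C * nrm z * 2^-1 ^+ n].
  have step_le x : nrm x <= C * nrm (rest (s n)) -> nrm x <= C * nrm z * 2^-1 ^+ n.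
    move=> /le_trans; apply; rewrite -mulrA ler_pM2l//; exact: (restP n).2.
  have [Zn _] := restP n; have [_ _ _ /step_le ny /step_le nf] := gP _ Zn.
  split; last 2 first.
  - by rewrite /= addrC addKr.
  - by rewrite /= addrC addKr.
  - elim: n {ny nf step_le Zn} => [|n IH] /=; first exact: subspace0.
    by apply: subspaceD => //; have [] := gP _ (restP n).1.
  - elim: n {ny nf step_le Zn} => [|n IH] /=; first exact: subspace0.
    by apply: subspaceD => //; have [] := gP _ (restP n).1.
have [n|y yP] := @geometric_cvg _ _ (fun n => (s n).1) (C * nrm z).
  by have [] := sP n.
have [n|f fP] := @geometric_cvg _ _ (fun n => (s n).2) (C * nrm z).
  by have [] := sP n.
have Cz0 : 0 <= 2 * (C * nrm z) by rewrite !mulr_ge0 ?nrm_ge0// ltW.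
exists y, f; split.
- by apply: (closed_geometric cY _ _ yP) => // n; have [] := sP n.
- by apply: (closed_geometric cF _ _ fP) => // n; have [] := sP n.
- apply/subr0_eq/nrm_eq0/eqP; rewrite eq_le nrm_ge0 andbT.
  apply: (@ler_geometric _ _ _ (nrm z + K * (2 * (C * nrm z)) + 2 * (C * nrm z))).
    by rewrite !addr_ge0 ?nrm_ge0// mulr_ge0// ltW.
  move=> n; rewrite add0r 2!mulrDl.
  have -> : z - (T y + f) = rest (s n) - (T (y - (s n).1) + (f - (s n).2)).
    by rewrite /rest linearB addrACA -opprD opprB subrKA.
  rewrite (le_trans (nrmD _ _))// nrmN -addrA; apply: lerD; first exact: (restP n).2.
  rewrite (le_trans (nrmD _ _))//; apply: lerD; last exact: fP.
  by rewrite (le_trans (TK _))// -mulrA ler_pM2l.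
- by have := yP 0; rewrite /= subr0 expr0 mulr1 mulrA.
- by have := fP 0; rewrite /= subr0 expr0 mulr1 mulrA.
Qed.

End Surjection.

(** Kato: a range that is complemented by a closed subspace is closed. *)
Lemma closed_complemented_range Y F :
  closed Y -> subspace_set Y -> closed F -> subspace_set F ->
  closed (sumset (T @` Y) F) -> T @` Y `&` F = [set 0] -> closed (T @` Y).
Proof.
move=> cY sY cF sF cZ TYF.
have sZ : subspace_set (sumset (T @` Y) F).
  by apply: subspace_sumset => //; exact: subspace_image.
have [C C0 op] := open_mapping cY sY cF sF cZ sZ erefl.
have unique u f f' : (T @` Y) u -> F f -> F f' -> u + f' = f -> f' = f.
  move=> TYu Ff Ff' uff'; have : (T @` Y `&` F) (f - f').
    split; last exact: subspaceB.
    by rewrite -uff' addrK.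
  by rewrite TYF /= => /subr0_eq.
apply/closed_nrmP => z zTY.
have Zz : sumset (T @` Y) F z.
  move/closed_nrmP: cZ; apply => e /zTY[u TYu ze]; exists u => //.
  exact: sumsetl.
case: Zz => u [f [TYu Ff zE]].
have f0 : f = 0.
  apply/nrm_eq0/eqP; rewrite eq_le nrm_ge0 andbT; apply/ler_addgt0Pr => e e0.
  have [|v [y Yy Tyv] zv] := zTY (e / C); first by rewrite divr_gt0.
  have [|y' [f' [Yy' Ff' zvE _ nf']]] := op (z - v).
    exists (u - v), f; split=> //; last by rewrite zE addrAC.
    by apply: subspaceB => //; [exact: subspace_image|exists y].
  have -> : f = f'.
    apply/esym/(unique (T y' - (u - v))) => //.
      apply: subspaceB; [exact: subspace_image|by exists y'|].
      by apply: subspaceB => //; [exact: subspace_image|exists y].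
    by rewrite addrAC -zvE zE opprB subrKA addrAC subrr add0r.
  by rewrite add0r (le_trans nf')// mulrC -ler_pdivlMr// ltW.
by rewrite zE f0 addr0.
Qed.

Lemma open_onto_range M :
  closed M -> subspace_set M -> closed (T @` M) ->
  exists2 C : R, 0 < C & forall z, (T @` M) z ->
    exists y, [/\ M y, T y = z & nrm y <= C * nrm z].
Proof.
move=> cM sM cTM.
have TM0 : T @` M = sumset (T @` M) [set 0].
  apply/seteqP; split=> [x TMx|_ [x [_ [TMx -> ->]]]]; last by rewrite addr0.
  by exists x, 0; rewrite addr0.
have [C C0 op] := open_mapping cM sM (@closed_set0 _ _) (@subspace_set0 _ _) cTM
  (subspace_image T sM) TM0.
exists C => // z /op[y [_ [My -> -> ny _]]]; exists y.
by rewrite addr0 in ny *.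
Qed.

(** The image of a closed subspace that contains the kernel is closed when the
    whole range is: the open mapping corrects approximate preimages. *)
Lemma closed_image_saturated M U :
  closed M -> subspace_set M -> closed (T @` M) ->
  closed U -> subspace_set U -> U `<=` M -> ker_on T M `<=` U -> closed (T @` U).
Proof.
move=> cM sM cTM cU sU UM kU.
have [C C0 op] := open_onto_range cM sM cTM.
apply/closed_nrmP => z zTU.
have [m Mm Tmz] : (T @` M) z.
  move/closed_nrmP: cTM; apply => e /zTU[_ [u Uu <-] ze].
  by exists (T u) => //; exists u => //; exact: UM.
exists m => //; move/closed_nrmP: cU; apply => e e0.
have [|_ [u Uu <-] zu] := zTU (e / C); first by rewrite divr_gt0.
have [|y [My zuE ny]] := op (z - T u).
  by exists (m - u); [apply: subspaceB => //; exact: UM|rewrite linearB Tmz].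
exists (m - y); last by rewrite opprB addrC subrK (le_lt_trans ny)// mulrC -ltr_pdivlMr.
rewrite -(subrK u (m - y)); apply: subspaceD => //; apply: kU; split.
  by apply: subspaceB => //; [exact: subspaceB|exact: UM].
by rewrite !linearB zuE Tmz opprB [z + _]addrC subrK subrr.
Qed.

Lemma injective_bounded_below Z :
  closed Z -> subspace_set Z -> closed (T @` Z) -> ker_on T Z `<=` [set 0] ->
  exists2 C : R, 0 < C & forall z, Z z -> nrm z <= C * nrm (T z).
Proof.
move=> cZ sZ cTZ inj; have [C C0 op] := open_onto_range cZ sZ cTZ.
exists C => // z Zz; have [|y [Zy Tyz ny]] := op (T z); first by exists z.
suff -> : z = y by rewrite Tyz in ny *.
apply/subr0_eq/inj; split; first exact: subspaceB.
by rewrite linearB Tyz subrr.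
Qed.
End OpenMapping.

(** * The Hahn-Banach theorem *)

Lemma widen_ord_lift n (i : 'I_n) : widen_ord (leqnSn n) i = lift ord_max i.
Proof. by apply: val_inj; rewrite /= /bump leqNgt ltn_ord. Qed.

Section HahnBanach.
Variables (R : realType) (X : completeNormedModType R[i]).
Implicit Types (x y z e : X) (W : set X) (p q : X -> R).

Definition sublinear p : Prop :=
  (forall x y, p (x + y) <= p x + p y) /\
  (forall (t : R) x, 0 < t -> p (t%:C *: x) <= t * p x).

Lemma sublinear0 p : sublinear p -> p 0 = 0.
Proof.
move=> [_ hp]; have := hp 2 0 (ltr0n _ 2); have := hp 2^-1 0.
by rewrite !scaler0 invr_gt0 => /(_ (ltr0n _ 2)); lra.
Qed.

Lemma sublinearZ p (t : R) x : sublinear p -> 0 <= t -> p (t%:C *: x) = t * p x.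
Proof.
move=> sp t0; have [->|tn0] := eqVneq t 0.
  by rewrite scale0r mul0r sublinear0.
have {tn0}t0 : 0 < t by rewrite lt_def tn0.
apply/eqP; rewrite eq_le sp.2//= -ler_pdivlMl//.
have tc0 := complexr_neq0 t0.
by rewrite -{1}(scalerK tc0 x) -fmorphV sp.2// invr_gt0.
Qed.

Lemma sublinearN p x : sublinear p -> - p (- x) <= p x.
Proof.
by move=> sp; have := sp.1 x (- x); rewrite subrr (sublinear0 sp); lra.
Qed.

Lemma inf_leD (A B C : set R) : B !=set0 -> C !=set0 -> has_lbound A ->
  (forall b c, B b -> C c -> exists2 a, A a & a <= b + c) -> inf A <= inf B + inf C.
Proof.
move=> B0 C0 lA H; rewrite -lerBlDr; apply: lb_le_inf => // b Bb.
rewrite lerBlDr -lerBlDl; apply: lb_le_inf => // c Cc; rewrite lerBlDl.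
by have [a Aa] := H _ _ Bb Cc; apply: le_trans; exact: ge_inf.
Qed.

Lemma inf_leM (t : R) (A B : set R) : 0 < t -> B !=set0 -> has_lbound A ->
  (forall b, B b -> exists2 a, A a & a <= t * b) -> inf A <= t * inf B.
Proof.
move=> t0 B0 lA H; rewrite -ler_pdivrMl//; apply: lb_le_inf => // b Bb.
rewrite ler_pdivrMl//; have [a Aa] := H _ Bb; apply: le_trans; exact: ge_inf.
Qed.

(** Lowers [p] as far as sublinearity allows when its value at [- e] is pushed
    down to [- p e]. *)
Lemma sublinear_lower p e : sublinear p -> exists q,
  [/\ sublinear q, forall x, q x <= p x, q (- e) <= - p e
    & forall x, q x <= p (x + e) - p e].
Proof.
move=> sp; have [pD pZ] := sp.
pose S x := [set p (x + t%:C *: e) - t * p e | t in [set t : R | 0 <= t]].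
have S0 x : S x !=set0 by exists (p (x + 0%:C *: e) - 0 * p e), 0 => /=.
have lS x : has_lbound (S x).
  exists (- p (- x)) => _ [t /= t0 <-].
  rewrite -sublinearZ//; have := pD (x + t%:C *: e) (- x).
  by rewrite addrAC subrr add0r; lra.
exists (fun x => inf (S x)); split.
- split=> [x y|t x t0].
    apply: inf_leD => // _ _ [t /= t0 <-] [s /= s0 <-].
    exists (p (x + y + (t + s)%:C *: e) - (t + s) * p e).
      by exists (t + s) => //=; rewrite addr_ge0.
    have := pD (x + t%:C *: e) (y + s%:C *: e).
    by rewrite addrACA -scalerDl -rmorphD /= mulrDl; lra.
  apply: inf_leM => // _ [s /= s0 <-].
  exists (p (t%:C *: x + (t * s)%:C *: e) - (t * s) * p e).
    by exists (t * s) => //=; rewrite mulr_ge0// ltW.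
  have := pZ _ (x + s%:C *: e) t0.
  by rewrite rmorphM /= -scalerA -scalerDr mulrBr mulrA; lra.
- move=> x; apply: ge_inf => //; exists 0 => //=.
  by rewrite scale0r addr0 mul0r subr0.
- apply: ge_inf => //; exists 1 => //=.
  by rewrite scale1r addNr (sublinear0 sp) mul1r sub0r.
- move=> x; apply: ge_inf => //; exists 1 => //=.
  by rewrite scale1r mul1r.
Qed.

(** Zorn's lemma; the infimum of a chain of sublinear functionals is sublinear. *)
Lemma minimal_sublinear p : sublinear p -> exists q,
  [/\ sublinear q, forall x, q x <= p x
    & forall q', sublinear q' -> (forall x, q' x <= q x) -> forall x, q x <= q' x].
Proof.
move=> sp; pose T := {q | sublinear q /\ forall x, q x <= p x}.
pose r (q q' : T) := `[< forall x, sval q' x <= sval q x >].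
have [|||[q [sq qp]] qmin] := @ZL_preorder T (exist _ p (conj sp (fun x => lexx _))) r.
- by move=> q; apply/asboolP.
- by move=> q1 q2 q3 /asboolP h12 /asboolP h23; apply/asboolP => x; exact: le_trans (h12 x).
- move=> A totA; have [[q0 Aq0]|A0] := pselect (A !=set0); last first.
    exists (exist _ p (conj sp (fun x => lexx _))) => q Aq.
    by exfalso; apply: A0; exists q.
  pose S x := [set sval q x | q in A].
  have S0 x : S x !=set0 by exists (sval q0 x), q0.
  have lS x : has_lbound (S x).
    exists (- p (- x)) => _ [[q [sq qp]] _ <-] /=.
    by rewrite (le_trans _ (sublinearN _ sq))// lerN2.
  have sS : sublinear (fun x => inf (S x)).
    split=> [x y|t x t0].
      apply: inf_leD => // _ _ [q1 Aq1 <-] [q2 Aq2 <-].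
      have [/asboolP h|/asboolP h] := totA _ _ Aq1 Aq2.
        exists (sval q2 (x + y)); first by exists q2.
        by case: q2 {Aq2} h => q2 [[q2D _] _] /= h; rewrite (le_trans (q2D _ _))// lerD2r.
      exists (sval q1 (x + y)); first by exists q1.
      by case: q1 {Aq1} h => q1 [[q1D _] _] /= h; rewrite (le_trans (q1D _ _))// lerD2l.
    apply: inf_leM => // _ [q Aq <-]; exists (sval q (t%:C *: x)); first by exists q.
    by case: q {Aq} => q [[_ qZ] _] /=; exact: qZ.
  have Sp x : inf (S x) <= p x.
    have : inf (S x) <= sval q0 x by apply: ge_inf => //; exists q0.
    by move/le_trans; apply; case: q0 {Aq0 S0} => q0 [].
  exists (exist _ (fun x => inf (S x)) (conj sS Sp) : T) => q Aq; apply/asboolP => x /=.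
  by apply: ge_inf => //; exists q.
exists q; split=> // q' sq' q'q x.
have q'p y : q' y <= p y by exact: le_trans (q'q y) _.
have /asboolP : r (exist _ q' (conj sq' q'p)) (exist _ q (conj sq qp)).
  by apply: qmin; apply/asboolP.
exact.
Qed.

(** By minimality [q] cannot be lowered in the direction of [y], which bounds it
    by [q (x + y) - q y]. *)
Lemma minimal_sublinear_additive q : sublinear q ->
  (forall q', sublinear q' -> (forall x, q' x <= q x) -> forall x, q x <= q' x) ->
  forall x y, q (x + y) = q x + q y.
Proof.
move=> sq qmin x y; apply/eqP; rewrite eq_le sq.1/=.
have [q' [sq' q'q _ q'D]] := sublinear_lower y sq.
by have := qmin _ sq' q'q x; have := q'D x; lra.
Qed.

(** A functional that is only real-linear is turned into a complex one by
    [f x - i * f (i * x)]; the distance to [W] bounds it and kills [W]. *)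
Theorem hahn_banach W e : closed W -> subspace_set W -> ~ W e ->
  exists phi : X -> R[i],
    [/\ forall (a : R[i]) x y, phi (a *: x + y) = a * phi x + phi y,
        forall w, W w -> phi w = 0, phi e = 1
      & exists2 K : R, 0 < K & forall x y, nrm (phi x *: y) <= K * nrm x * nrm y].
Proof.
move=> cW sW We.
pose S x := [set nrm (x - w) | w in W].
have S0 x : S x !=set0 by exists (nrm (x - 0)), 0 => //; exact: subspace0.
have lS x : has_lbound (S x) by exists 0 => _ [w _ <-]; exact: nrm_ge0.
pose p x := inf (S x).
have sp : sublinear p.
  split=> [x y|t x t0].
    apply: inf_leD => // _ _ [v Wv <-] [w Ww <-].
    exists (nrm (x + y - (v + w))); first by exists (v + w) => //; exact: subspaceD.
    by rewrite opprD addrACA nrmD.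
  apply: inf_leM => // _ [w Ww <-]; exists (nrm (t%:C *: x - t%:C *: w)).
    by exists (t%:C *: w) => //; exact: subspaceZ.
  by rewrite -scalerBr nrmZr gtr0_norm.
have pn x : p x <= nrm x.
  by apply: ge_inf => //; exists 0; [exact: subspace0|rewrite subr0].
have pW w : W w -> p w <= 0.
  by move=> Ww; apply: ge_inf => //; exists w => //; rewrite subrr nrm0.
have pe : 0 < p e.
  rewrite ltNge; apply/negP => pe; apply: We; move/closed_nrmP: cW; apply => r r0.
  have [_ [w Ww <-] wr] : exists2 s, S e s & s < r.
    by apply/inf_lt => //; rewrite (le_lt_trans pe).
  by exists w.
have [q0 [sq0 q0p q0e _]] := sublinear_lower e sp.
have [f [sf fq0 fmin]] := minimal_sublinear sq0.
have fD := minimal_sublinear_additive sf fmin.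
have fN x : f (- x) = - f x.
  by apply/eqP; rewrite -addr_eq0 -fD addNr sublinear0.
have fZ (t : R) x : f (t%:C *: x) = t * f x.
  have [t0|t0] := leP 0 t; first exact: sublinearZ.
  rewrite -[t in LHS]opprK rmorphN scaleNr fN sublinearZ// ?oppr_ge0 ?ltW//.
  by rewrite mulNr opprK.
have fp x : f x <= p x by rewrite (le_trans (fq0 x)).
have fW w : W w -> f w = 0.
  move=> Ww; have := fp w; have := fp (- w); rewrite fN.
  by have := pW _ Ww; have := pW _ (subspaceN sW Ww); lra.
have fe : 0 < f e.
  by rewrite (lt_le_trans pe)// -lerN2 -fN (le_trans (fq0 _)).
have fn x : `|f x| <= nrm x.
  rewrite ler_norml -[_ <= f x]lerN2 opprK -fN (le_trans (fp _))/=; last first.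
    by rewrite (le_trans (pn _))// nrmN.
  by rewrite (le_trans (fp _)).
pose phi x := f x +i* (- f ('i *: x)).
have phiD x y : phi (x + y) = phi x + phi y.
  by rewrite /phi scalerDr !fD opprD.
have phiZr (t : R) x : phi (t%:C *: x) = t%:C * phi x.
  by rewrite /phi scalerA mulrC -scalerA !fZ; simpc; rewrite ?mulrN.
have phiZi x : phi ('i *: x) = 'i * phi x.
  rewrite /phi scalerA.
  have -> : 'i * 'i = -1 :> R[i] by rewrite -expr2 sqr_i.
  by rewrite scaleN1r fN opprK; simpc.
have phiZ (a : R[i]) x : phi (a *: x) = a * phi x.
  rewrite [a]complexE scalerDl phiD -scalerA phiZi !phiZr mulrDl mulrA//.
have phie0 : phi e != 0.
  by rewrite eq_complex /= negb_and gt_eqF.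
exists (fun x => phi x / phi e); split.
- by move=> a x y; rewrite phiD phiZ mulrDl mulrA.
- move=> w Ww; suff -> : phi w = 0 by rewrite mul0r.
  by rewrite /phi (fW w)// (fW _ (subspaceZ _ sW Ww)) oppr0.
- exact: divff.
have phin x y : nrm (phi x *: y) <= 2 * nrm x * nrm y.
  rewrite [phi x]complexE scalerDl (le_trans (nrmD _ _))// -scalerA (nrmZ 'i) !nrmZr.
  have -> : complex.Re `|'i : R[i]| = 1.
    by rewrite normc_def /= expr0n expr1n /= add0r sqrtr1.
  rewrite mul1r -mulrDl ler_wpM2r ?nrm_ge0// mulr_natl mulr2n.
  apply: lerD; first exact: fn.
  have -> : nrm x = nrm ('i *: x); last by rewrite /phi /= normrN; exact: fn.
  by rewrite nrmZ normc_def /= expr0n expr1n /= add0r sqrtr1 mul1r.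
exists (2 * complex.Re `|(phi e)^-1|).
  by rewrite mulr_gt0// -ltcR RRe_real ?normr_real// normr_gt0 invr_eq0.
move=> x y; rewrite mulrC -scalerA nrmZ [2 * _]mulrC -!mulrA ler_wpM2l//.
  by rewrite -ler0c RRe_real ?normr_real.
by rewrite mulrA.
Qed.

(** Subtracting the component along [e] reduces closedness of [W + C e] to that
    of [W]. *)
Lemma closed_add_line W e : closed W -> subspace_set W ->
  closed [set x | exists c : R[i], W (x - c *: e)].
Proof.
move=> cW sW; have [We|We] := pselect (W e).
  suff -> : [set x | exists c : R[i], W (x - c *: e)] = W by [].
  apply/seteqP; split=> [x [c Wx]|x Wx]; last by exists 0; rewrite scale0r subr0.
  by rewrite -(subrK (c *: e) x); apply: subspaceD => //; exact: subspaceZ.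
have [phi [phiL phiW phie [K K0 phiK]]] := hahn_banach cW sW We.
apply/closed_nrmP => x xA; exists (phi x); move/closed_nrmP: cW; apply => r r0.
have [|a [c Wa] xa] := xA (r / (1 + K * nrm e)).
  by rewrite divr_gt0// ltr_pwDl// mulr_ge0 ?nrm_ge0// ltW.
exists (a - c *: e) => //.
have phia : phi a = c.
  by rewrite -(subrK (c *: e) a) addrC phiL (phiW _ Wa) phie mulr1 addr0.
have -> : x - phi x *: e - (a - c *: e) = (x - a) - phi (x - a) *: e.
  have -> : phi (x - a) = phi x - c.
    by rewrite -scaleN1r addrC phiL phia mulN1r addrC.
  by rewrite scalerBl !opprB [c *: e - a]addrC addrACA [- (_ *: e) + _]addrC.
rewrite (le_lt_trans (nrmD _ _))// nrmN.
have := phiK (x - a) e; move: xa.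
rewrite ltr_pdivlMr; last by rewrite ltr_pwDl// mulr_ge0 ?nrm_ge0// ltW.
by rewrite mulrDr mulr1 mulrA [_ * K]mulrC; lra.
Qed.

(** A projection [P] onto the span of the first vectors extends to one more vector
    [d] by means of a continuous functional with value [1] at [d - P d]. *)
Lemma finite_projection n (e : 'I_n -> X) : exists P : {linear X -> X},
  [/\ continuous P, forall x, exists c : 'I_n -> R[i], P x = \sum_(i < n) c i *: e i
    & forall c : 'I_n -> R[i],
        P (\sum_(i < n) c i *: e i) = \sum_(i < n) c i *: e i].
Proof.
elim: n e => [|n IH] e.
  exists \0; split.
  - by move=> x; exact: cst_continuous.
  - by move=> x; exists (fun=> 0); rewrite big_ord0.
  - by move=> c; rewrite big_ord0.
have [P [cP PS PK]] := IH (fun i => e (widen_ord (leqnSn n) i)).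
set d := e ord_max.
have lastE (c : 'I_n.+1 -> R[i]) : \sum_(i < n.+1) c i *: e i =
  \sum_(i < n) c (widen_ord (leqnSn n) i) *: e (widen_ord (leqnSn n) i) + c ord_max *: d.
  by rewrite big_ord_recr.
have PP x : P (P x) = P x by have [c ->] := PS x; rewrite PK.
have [Pd|Pd] := eqVneq (P d) d.
  exists P; split=> // [x|c].
    have [c ->] := PS x; pose c' i := if unlift ord_max i is Some j then c j else 0.
    exists c'; rewrite lastE /c' unlift_none scale0r addr0; apply: eq_bigr => i _.
    by rewrite widen_ord_lift liftK.
  by rewrite lastE linearD linearZ/= Pd PK.
have [|phi [phiL phi0 phid [K K0 phiK]]] :=
  hahn_banach (@closed_set0 _ X) (@subspace_set0 _ X) (e := d - P d).
  by move=> /= /subr0_eq/esym/eqP; apply/negP.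
have QL : linear (fun x => P x + phi (x - P x) *: (d - P d)).
  move=> a x y; have -> : phi (a *: x + y - P (a *: x + y)) =
      a * phi (x - P x) + phi (y - P y).
    by rewrite linearP opprD addrACA -scalerBr phiL.
  by rewrite linearP; move: (d - P d) => u; rewrite scalerDl -scalerA scalerDr addrACA.
pose Q : {linear X -> X} :=
  HB.pack (fun x => P x + phi (x - P x) *: (d - P d)) (GRing.isLinear.Build _ _ _ _ _ QL).
have [CP CP0 PB] := (continuous_nrmP P).1 cP.
exists Q; split.
- apply/continuous_nrmP; exists (CP + K * (1 + CP) * (nrm (d - P d))).
    by rewrite ltr_pwDl// !mulr_ge0 ?nrm_ge0 ?addr_ge0 ?ltW.
  move=> x; rewrite [Q x]/= (le_trans (nrmD _ _))// mulrDl lerD//.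
  rewrite (le_trans (phiK _ _))// [leRHS]mulrAC ler_wpM2r ?nrm_ge0// -mulrA ler_pM2l//.
  by rewrite (le_trans (nrmD _ _))// nrmN mulrDl mul1r lerD.
- move=> x; have [c cE] := PS (x - phi (x - P x) *: d).
  pose c' i := if unlift ord_max i is Some j then c j else phi (x - P x).
  exists c'; rewrite lastE /c' unlift_none.
  have -> : \sum_(i < n) (if unlift ord_max (widen_ord (leqnSn n) i) is Some j then c j
      else phi (x - P x)) *: e (widen_ord (leqnSn n) i) = P (x - phi (x - P x) *: d).
    by rewrite cE; apply: eq_bigr => i _; rewrite !widen_ord_lift liftK.
  by rewrite linearB linearZ/= scalerBr addrA addrAC.
move=> c; rewrite lastE; set s := \sum_(i < n) _; set a := c ord_max.
have Ps : P s = s by rewrite PK.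
have -> : Q (s + a *: d) = Q s + a *: Q d by rewrite linearD linearZ.
rewrite /= Ps phid subrr.
have phi_0 : phi 0 = 0 by apply: phi0.
by rewrite phi_0 scale0r addr0 scale1r [P d + _]addrC subrK.
Qed.

End HahnBanach.

(** * Dimensions of quotients *)

Section Dimension.
Variables (R : realType) (X : completeNormedModType R[i]).
Implicit Types (x y z : X) (A B C U V W : set X).

Definition has_dim V W n := exists e : 'I_n -> X, quot_basis V W e.

Definition fin_dim V W := exists n, has_dim V W n.

Definition independent_mod W n (e : 'I_n -> X) :=
  forall c : 'I_n -> R[i], W (\sum_(i < n) c i *: e i) -> forall i, c i = 0.

(** With more vectors than basis elements, the coefficient matrix has a nonzero
    row in its kernel, which is a relation between the vectors. *)
Lemma independent_le V W n (e : 'I_n -> X) m (f : 'I_m -> X) :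
  subspace_set W -> quot_basis V W e -> (forall j, V (f j)) ->
  independent_mod W f -> (m <= n)%N.
Proof.
move=> sW [_ _ eV] fV indf; rewrite leqNgt; apply/negP => nm.
have [a aP] := choice (fun j => eV _ (fV j)).
pose A := \matrix_(j < m, i < n) a j i.
have : kermx A != 0.
  by rewrite kermx_eq0 -row_leq_rank -ltnNge (leq_ltn_trans (rank_leq_col A)).
move=> /rowV0Pn[u /sub_kermxP uA u0]; case/negP: u0; apply/eqP/rowP => j.
rewrite mxE; move: j; apply: indf.
have -> : \sum_(j < m) u 0 j *: f j =
    \sum_(j < m) u 0 j *: (f j - \sum_(i < n) a j i *: e i).
  apply/eqP; rewrite -subr_eq0 -sumrB; apply/eqP.
  under eq_bigr => j _ do rewrite -scalerBr opprB addrC subrK scaler_sumr.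
  rewrite exchange_big /= big1// => i _.
  under eq_bigr => j _ do rewrite scalerA.
  rewrite -scaler_suml; have /rowP/(_ i) := uA; rewrite !mxE => uAi.
  have -> : \sum_(j < m) u 0 j * a j i = 0.
    by rewrite -[RHS]uAi; apply: eq_bigr => j _; rewrite mxE.
  by rewrite scale0r.
by apply: subspace_sum => // j; exact: subspaceZ.
Qed.

Lemma has_dim_uniq V W n m :
  subspace_set W -> has_dim V W n -> has_dim V W m -> n = m.
Proof.
move=> sW [e eP] [f fP]; apply/eqP; rewrite eqn_leq; apply/andP; split.
- by have [eV ei _] := eP; exact: (independent_le sW fP eV ei).
- by have [fV fi _] := fP; exact: (independent_le sW eP fV fi).
Qed.

(** A maximal independent family is a basis. *)
Lemma fin_dim_bounded V W n : subspace_set W ->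
  (forall m (f : 'I_m -> X), (forall j, V (f j)) -> independent_mod W f -> (m <= n)%N) ->
  fin_dim V W.
Proof.
move=> sW bound.
pose P m := `[< exists f : 'I_m -> X, (forall j, V (f j)) /\ independent_mod W f >].
have exP : exists m, P m.
  by exists 0%N; apply/asboolP; exists (fun=> 0); split=> [[]//|c _ []].
have Pn m : P m -> (m <= n)%N by move=> /asboolP[f [fV fi]]; exact: bound fi.
case: (ex_maxnP exP Pn) => m /asboolP[f [fV fi]] mmax.
exists m, f; split=> // x Vx; apply: contrapT => nox.
have [m1|] := boolP (P m.+1); first by have := mmax _ m1; rewrite ltnn.
move=> /asboolP; apply.
exists (fun i => if unlift ord_max i is Some j then f j else x); split=> [i|c].
  by case: unliftP => [j _|_]; [exact: fV|].
rewrite big_ord_recr /= unlift_none.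
under eq_bigr => i _ do rewrite widen_ord_lift liftK.
move=> Wc; have cmax : c ord_max = 0.
  apply: contrapT => /eqP c0; apply: nox.
  exists (fun i => - (c ord_max)^-1 * c (lift ord_max i)).
  suff -> : x - \sum_(i < m) - (c ord_max)^-1 * c (lift ord_max i) *: f i =
    (c ord_max)^-1 *: (\sum_(i < m) c (lift ord_max i) *: f i + c ord_max *: x).
    exact: subspaceZ.
  rewrite scalerDr scalerA mulVf// scale1r addrC scaler_sumr; congr (_ + _).
  by rewrite -sumrN; apply: eq_bigr => i _; rewrite scalerA mulNr scaleNr opprK.
rewrite cmax scale0r addr0 in Wc => i.
by case: (unliftP ord_max i) => [j ->|->//]; exact: fi Wc j.
Qed.

Lemma fin_dim_sub U V W : subspace_set W -> V `<=` U ->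
  fin_dim U W -> fin_dim V W.
Proof.
move=> sW VU [n [e eP]]; apply: (@fin_dim_bounded _ _ n) => // m f fV fi.
by apply: (independent_le sW eP _ fi) => j; exact: VU.
Qed.

Lemma fin_dim_quo U V W : subspace_set W -> subspace_set V -> W `<=` V ->
  fin_dim U W -> fin_dim U V.
Proof.
move=> sW sV WV [n [e eP]]; apply: (@fin_dim_bounded _ _ n) => // m f fU fi.
by apply: (independent_le sW eP fU) => c /WV/fi.
Qed.

(** A basis of [V] modulo [W] followed by one of [U] modulo [V]. *)
Lemma has_dim_add U V W n m : subspace_set W -> subspace_set V ->
  W `<=` V -> V `<=` U -> has_dim V W n -> has_dim U V m -> has_dim U W (n + m).
Proof.
move=> sW sV WV VU [e [eV ei eB]] [f [fU fi fB]].
exists (fun i : 'I_(n + m) => match fintype.split i with inl j => e j | inr j => f j end).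
have sumE (c : 'I_(n + m) -> R[i]) : \sum_(i < n + m) c i *:
    match fintype.split i with inl j => e j | inr j => f j end =
    \sum_(i < n) c (lshift m i) *: e i + \sum_(i < m) c (rshift n i) *: f i.
  rewrite big_split_ord /=; congr (_ + _); apply: eq_bigr => i _.
    by rewrite (unsplitK (inl i)).
  by rewrite (unsplitK (inr i)).
split=> [i|c|x Ux].
- by case: (fintype.split i) => j; [exact/VU/eV|exact: fU].
- rewrite sumE => Wc.
  have Ve : V (\sum_(i < n) c (lshift m i) *: e i).
    by apply: subspace_sum => // i; exact: subspaceZ.
  have cr i : c (rshift n i) = 0.
    apply: (fi (fun i => c (rshift n i))).
    by rewrite -[X in V X](addKr (\sum_(i < n) c (lshift m i) *: e i)); apply: subspaceD;
      [|exact: subspaceN|exact: WV].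
  have cl i : c (lshift m i) = 0.
    apply: (ei (fun i => c (lshift m i))); move: Wc; rewrite [X in _ + X]big1 ?addr0// => j _.
    by rewrite cr scale0r.
  by move=> i; rewrite -(splitK i); case: (fintype.split i) => j /=.
- have [d dV] := fB _ Ux; have [c cW] := eB _ dV.
  exists (fun i : 'I_(n + m) => match fintype.split i with inl j => c j | inr j => d j end).
  rewrite sumE (eq_bigr (fun i => c i *: e i)); last first.
    by move=> i _; rewrite (unsplitK (inl i)).
  rewrite [X in _ - (_ + X)](eq_bigr (fun i => d i *: f i)); last first.
    by move=> i _; rewrite (unsplitK (inr i)).
  by rewrite opprD addrA addrAC.
Qed.

Lemma has_dim0 V W : subspace_set W -> (has_dim V W 0 <-> V `<=` W).
Proof.
move=> sW; split=> [[e [_ _ eB]] x /eB[c]|VW]; first by rewrite big_ord0 subr0.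
exists (fun=> 0); split=> [[]//|c _ []//|x /VW Wx].
by exists (fun=> 0); rewrite big_ord0 subr0.
Qed.

(** Second isomorphism theorem. *)
Lemma has_dim_sumset A B C n : subspace_set A -> subspace_set B -> subspace_set C ->
  B `<=` A -> A `&` sumset B C `<=` B ->
  has_dim (sumset A C) (sumset B C) n <-> has_dim A B n.
Proof.
move=> sA sB sC BA ABC; have sBC := subspace_sumset sB sC; split=> -[e [eV ei eB]].
  have /choice[f fP] : forall i, exists y, A y /\ C (e i - y).
    move=> i; have [a [c [Aa Cc ->]]] := eV i; by exists a; rewrite addrC addKr.
  exists f; split=> [i|c Bc|x Ax]; first by have [] := fP i.
    apply: ei; rewrite -[X in sumset _ _ X](addrNK (\sum_(i < n) c i *: f i)) addrC.
    exists (\sum_(i < n) c i *: f i), (\sum_(i < n) c i *: (e i - f i)).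
    split=> //; first by apply: subspace_sum => // i; apply: subspaceZ => //; have [] := fP i.
    by congr (_ + _); rewrite -sumrB; apply: eq_bigr => i _; rewrite scalerBr.
  have [c cB] := eB _ (sumsetl sC Ax); exists c; apply: ABC; split.
    by apply: subspaceB => //; apply: subspace_sum => // i; apply: subspaceZ => //; have [] := fP i.
  have -> : x - \sum_(i < n) c i *: f i =
      (x - \sum_(i < n) c i *: e i) + \sum_(i < n) c i *: (e i - f i).
    under [X in _ = _ + X]eq_bigr => i _ do rewrite scalerBr.
    by rewrite sumrB addrA subrK.
  apply: subspaceD => //; apply: sumsetr => //.
  by apply: subspace_sum => // i; apply: subspaceZ => //; have [] := fP i.
exists e; split=> [i|c Bc|_ [a [c [Aa Cc ->]]]]; first exact: sumsetl.
  apply: ei; apply: ABC; split=> //.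
  by apply: subspace_sum => // i; exact: subspaceZ.
have [d dB] := eB _ Aa; exists d; exists (a - \sum_(i < n) d i *: e i), c.
by rewrite addrAC.
Qed.

Lemma has_dim_image (T : {linear X -> X}) U W n : subspace_set U -> subspace_set W ->
  W `<=` U -> ker_on T U `<=` W -> has_dim (T @` U) (T @` W) n <-> has_dim U W n.
Proof.
move=> sU sW WU kW.
have TUW x : U x -> (T @` W) (T x) -> W x.
  move=> Ux [w Ww Twx]; rewrite -(subrK w x); apply: subspaceD => //; apply: kW.
  by split; [apply: subspaceB => //; exact: WU|rewrite linearB Twx subrr].
have Tsum (c : 'I_n -> R[i]) (e : 'I_n -> X) :
    T (\sum_(i < n) c i *: e i) = \sum_(i < n) c i *: T (e i).
  by rewrite linear_sum; apply: eq_bigr => i _; rewrite linearZ.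
split=> -[e [eV ei eB]].
  have /choice[f fP] : forall i, exists y, U y /\ T y = e i.
    by move=> i; have [y] := eV i; exists y.
  have fE (c : 'I_n -> R[i]) : T (\sum_(i < n) c i *: f i) = \sum_(i < n) c i *: e i.
    by rewrite Tsum; apply: eq_bigr => i _; rewrite (fP i).2.
  exists f; split=> [i|c Wc|x Ux]; first by have [] := fP i.
    by apply: ei; rewrite -fE; exists (\sum_(i < n) c i *: f i).
  have [|c cP] := eB (T x); first by exists x.
  exists c; apply: TUW; last by rewrite linearB fE.
  by apply: subspaceB => //; apply: subspace_sum => // i; apply: subspaceZ => //; have [] := fP i.
exists (T \o e); split=> [i|c|_ [x Ux <-]]; first by exists (e i).
  by rewrite -Tsum => /TUW Wc; apply: ei; apply: Wc; apply: subspace_sum => // i; exact: subspaceZ.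
have [c cW] := eB _ Ux; exists c; rewrite -Tsum -linearB.
by exists (x - \sum_(i < n) c i *: e i).
Qed.

Lemma qdimE V W n : subspace_set W -> has_dim V W n -> qdim V W = (n%:R)%:E.
Proof.
move=> sW Vn; rewrite /qdim /inf_nat.
have -> : [set n | exists e : 'I_n -> X, quot_basis V W e] = [set n].
  apply/seteqP; split=> [m Vm|_ ->//]; exact: has_dim_uniq Vm Vn.
by rewrite image_set1 ereal_inf1.
Qed.

Lemma qdim_fin V W : (qdim V W < +oo)%E -> fin_dim V W.
Proof.
move=> lt; apply: contrapT => nofin; move: lt; rewrite /qdim /inf_nat.
have -> : [set n | exists e : 'I_n -> X, quot_basis V W e] = set0.
  by apply/seteqP; split=> // n nV; apply: nofin; exists n.
by rewrite image_set0 ereal_inf0 ltxx.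
Qed.

Lemma qdim_eq V W V' W' : (forall n, has_dim V W n <-> has_dim V' W' n) ->
  qdim V W = qdim V' W'.
Proof.
by move=> eqd; rewrite /qdim; congr (inf_nat R _); apply/seteqP; split=> n /eqd.
Qed.

End Dimension.

(** * The index along the images of an operator *)

Section Index.
Variables (R : realType) (X : completeNormedModType R[i]) (T : {linear X -> X}).
Implicit Types (x y z : X) (A B C U V W M N : set X).

Lemma iter_is_linear n : linear (iter n T).
Proof. by move=> a x y; elim: n => //= n ->; rewrite linearP. Qed.

HB.instance Definition _ n :=
  GRing.isLinear.Build R[i] X X *:%R (iter n T) (iter_is_linear n).

Lemma image_iterS n A : iter n.+1 T @` A = T @` (iter n T @` A).
Proof. by rewrite -image_comp. Qed.

Lemma image_iterSr n A : iter n.+1 T @` A = iter n T @` (T @` A).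
Proof.
by rewrite image_comp; apply: eq_imagel => x _; exact: iterSr.
Qed.

Lemma image_iterD m n A : iter (m + n) T @` A = iter m T @` (iter n T @` A).
Proof.
by elim: m => [|m IH]; [rewrite add0n image_id|rewrite addSn !image_iterS IH].
Qed.

Lemma invariant_iter n A : T @` A `<=` A -> iter n T @` A `<=` A.
Proof.
move=> TA; elim: n => [|n IH]; first by rewrite image_id.
rewrite image_iterS; exact/(subset_trans _ TA)/image_subset.
Qed.

Lemma subspace_image_iter n A : subspace_set A -> subspace_set (iter n T @` A).
Proof. exact: subspace_image. Qed.

Definition finite_indices A n k :=
  has_dim (ker_on T A) [set 0] n /\ has_dim A (T @` A) k.

(** The two chains [A >= T A + ker T >= T A] and [ker T >= ker T `&` T A >= 0] have
    one isomorphic step, and [A / (T A + ker T)] is isomorphic to [T A / T (T A)].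
    Finiteness of either pair of dimensions in the hypothesis thus gives that
    of all four. *)
Lemma index_image A : subspace_set A -> T @` A `<=` A ->
  (fin_dim (ker_on T A) [set 0] /\ fin_dim (T @` A) (T @` (T @` A))) \/
  (fin_dim A (T @` A) /\ fin_dim (ker_on T (T @` A)) [set 0]) ->
  exists n k n' k', [/\ finite_indices A n k, finite_indices (T @` A) n' k'
                      & (n + k' = n' + k)%N].
Proof.
move=> sA TA; set B := T @` A; set K := ker_on T A; set K' := ker_on T B.
have sB : subspace_set B by exact: subspace_image.
have sK : subspace_set K by exact: subspace_ker.
have sK' : subspace_set K' by exact: subspace_ker.
have sKB : subspace_set (sumset K B) by exact: subspace_sumset.
have s0 := @subspace_set0 _ X.
have K'K : K' `<=` K by move=> x [Bx Tx]; split=> //; exact: TA.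
have BKB : B `<=` sumset K B by exact: sumsetr.
have KBA : sumset K B `<=` A.
  by move=> _ [x [y [[Ax _] By ->]]]; apply: subspaceD => //; exact: TA.
have K'BE : sumset K' B = B.
  apply/seteqP; split=> [_ [x [y [[Bx _] By ->]]]|]; last exact: sumsetr.
  exact: subspaceD.
have TKB : T @` sumset K B = T @` B.
  apply/seteqP; split=> [_ [_ [x [y [[_ Tx] By ->]]] <-]|]; last exact: image_subset.
  by exists y => //; rewrite linearD Tx add0r.
have iso1 m : has_dim (sumset K B) B m <-> has_dim K K' m.
  rewrite -{2}K'BE; apply: has_dim_sumset => // x [[Ax Tx]]; rewrite K'BE => Bx.
  by split.
have iso2 m : has_dim B (T @` B) m <-> has_dim A (sumset K B) m.
  by rewrite -TKB; apply: has_dim_image => //; exact: sumsetl.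
have K0 V : subspace_set V -> [set 0] `<=` V by move=> [V0 _] _ ->.
case=> [[[n Kn] [k' Bk']]|[[k Ak] [n' Kn']]].
- have [n' Kn'] : fin_dim K' [set 0].
    by apply: (fin_dim_sub s0 K'K); exists n.
  have [m Km] : fin_dim K K' by apply: (fin_dim_quo s0 sK' (K0 _ sK')); exists n.
  have nE : n = (n' + m)%N.
    by apply: (has_dim_uniq s0 Kn); apply: (has_dim_add s0 sK') => //; exact: K0.
  exists n, (m + k')%N, n', k'; split=> //; last by rewrite nE addnA.
  split=> //; apply: (has_dim_add sB sKB) => //; [exact/iso1|exact/iso2].
have [m Km] : fin_dim (sumset K B) B by apply: (fin_dim_sub sB KBA); exists k.
have [k' Ak'] : fin_dim A (sumset K B).
  by apply: (fin_dim_quo sB sKB BKB); exists k.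
have kE : k = (m + k')%N by apply: (has_dim_uniq sB Ak); apply: (has_dim_add sB sKB).
exists (n' + m)%N, k, n', k'; split; [| |by rewrite kE addnA].
- by split=> //; apply: (has_dim_add s0 sK') => //; [exact: K0|exact/iso1].
- by split=> //; exact/iso2.
Qed.

(** [T] induces a surjection of [A / T A] onto [T A / T (T A)]. *)
Lemma fin_def_image A : subspace_set A -> T @` A `<=` A ->
  fin_dim A (T @` A) -> fin_dim (T @` A) (T @` (T @` A)).
Proof.
move=> sA TA fA; have sTA := subspace_image T sA; have sK := subspace_ker T sA.
have [k Ak] : fin_dim A (sumset (ker_on T A) (T @` A)).
  by apply: (fin_dim_quo sTA _ _ fA); [exact: subspace_sumset|exact: sumsetr].
exists k; suff -> : T @` (T @` A) = T @` sumset (ker_on T A) (T @` A).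
  apply/has_dim_image => //; first exact: subspace_sumset.
    by move=> _ [x [y [[Ax _] By ->]]]; apply: subspaceD => //; exact: TA.
  exact: sumsetl.
apply/seteqP; split=> [|_ [_ [x [y [[_ Tx] By ->]]] <-]].
  by apply: image_subset; exact: sumsetr.
by exists y => //; rewrite linearD Tx add0r.
Qed.

(** Moving along the powers of [T] leaves the index unchanged; it suffices that one
    of the two dimensions is finite on [A] and the other one at the end of the
    chain, as is the case when only one of them is known to be finite on [A]. *)
Lemma index_iter j A : subspace_set A -> T @` A `<=` A ->
  (fin_dim (ker_on T A) [set 0] /\
     fin_dim (iter j T @` A) (T @` (iter j T @` A))) \/
  (fin_dim A (T @` A) /\ fin_dim (ker_on T (iter j T @` A)) [set 0]) ->
  exists n k n' k', [/\ finite_indices A n k,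
      finite_indices (iter j T @` A) n' k' & (n + k' = n' + k)%N].
Proof.
elim: j A => [|j IH] A sA TA.
  rewrite image_id => H.
  have [[n An] [k Ak]] : fin_dim (ker_on T A) [set 0] /\ fin_dim A (T @` A).
    by case: H => -[].
  by exists n, k, n, k.
rewrite image_iterSr => H.
have sTA := subspace_image T sA.
have TTA : T @` (T @` A) `<=` T @` A by exact: image_subset.
have [|n1 [k1 [n2 [k2 [[An1 Ak1] A2 E2]]]]] := IH _ sTA TTA.
  case: H => -[H1 H2]; [left|right]; split=> //; last exact: fin_def_image.
  by apply: (fin_dim_sub (@subspace_set0 _ X) _ H1) => x [TAx Tx]; split=> //; exact: TA.
have [|n [k [n' [k' [A1 [Kn' Ak'] E1]]]]] := index_image sA TA.
  by case: H => -[H1 H2]; [left|right]; split=> //; [exists k1|exists n1].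
exists n, k, n2, k2; split=> //.
have n'E := has_dim_uniq (@subspace_set0 _ X) Kn' An1.
have k'E := has_dim_uniq (subspace_image T sTA) Ak' Ak1.
by subst n' k'; apply/eqP; rewrite -(eqn_add2r k1) addnAC E1 -addnA (addnC k) addnA E2 addnAC.
Qed.

Lemma fred_indexE A n k : subspace_set A -> finite_indices A n k ->
  fred_index T A = (n%:R - k%:R)%:E.
Proof.
move=> sA [An Ak]; rewrite /fred_index /nullity /deficiency /vdim.
by rewrite (qdimE (@subspace_set0 _ X) An) (qdimE (subspace_image T sA) Ak).
Qed.

Lemma fredholm_indices A : fredholm T A -> exists n k, finite_indices A n k.
Proof.
move=> [_]; rewrite /fred_index fin_numB => /andP[nA dA].
have [|n An] := @qdim_fin _ _ (ker_on T A) [set 0]; first by rewrite ltey_eq nA.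
have [|k Ak] := @qdim_fin _ _ A (T @` A); first by rewrite ltey_eq dA.
by exists n, k.
Qed.

End Index.

(** * Semi-regular operators and their nilpotent complements *)

Section SemiRegular.
Variables (R : realType) (X : completeNormedModType R[i]) (T : {linear X -> X}).
Hypothesis contT : continuous T.
Implicit Types (x y z : X) (A B C U V W M N Y : set X).

Lemma iter_bounded i : exists2 C : R, 0 < C & forall x, nrm (iter i T x) <= C * nrm x.
Proof.
have [D D0 HD] := (continuous_nrmP T).1 contT.
elim: i => [|i [C C0 HC]]; first by exists 1 => // x; rewrite mul1r.
exists (D * C); first exact: mulr_gt0.
by move=> x; rewrite /= (le_trans (HD _))// -mulrA ler_pM2l.
Qed.

(** The inclusion that defines semi-regularity propagates from the kernel of [T] to
    those of its powers by correcting an approximate preimage. *)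
Lemma semi_regular_ker_iter M j k : subspace_set M -> T @` M `<=` M ->
  semi_regular T M -> ker_on (iter j T) M `<=` iter k T @` M.
Proof.
move=> sM TM [_ kM]; elim: j k => [|j IH] k x [Mx Tx].
  by rewrite [x]Tx; apply: subspace0; exact: subspace_image.
have Mj : M (iter j T x) by apply: (invariant_iter (n := j) TM); exists x.
have [y My Tjk] : (iter (j + k) T @` M) (iter j T x) by apply: kM.
have sI := subspace_image_iter T k sM.
rewrite -(subrK (iter k T y) x); apply: subspaceD => //.
apply: IH; split; last by rewrite linearB /= -iterD Tjk subrr.
by apply: subspaceB => //; apply: (invariant_iter (n := k) TM); exists y.
Qed.

Lemma semi_regular_closed_iter M k : closed M -> subspace_set M ->
  T @` M `<=` M -> semi_regular T M -> closed (iter k T @` M).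
Proof.
move=> cM sM TM srM; elim: k => [|k IH]; first by rewrite image_id.
rewrite image_iterS; apply: (closed_image_saturated contT cM) => //.
- by case: srM.
- exact: subspace_image.
- exact: invariant_iter.
- by move=> x kx; have [_ kM] := srM; exact: (kM x kx k I).
Qed.

Lemma finite_indices_fredholm A n k :
  subspace_set A -> finite_indices T A n k -> fredholm T A.
Proof.
move=> sA [An Ak]; split; last by rewrite (fred_indexE sA (conj An Ak)).
by right; rewrite /lower_semi_fredholm /deficiency (qdimE (subspace_image T sA) Ak) ltry.
Qed.

Lemma fredholm_iter M j : subspace_set M -> T @` M `<=` M -> fredholm T M ->
  exists n k n' k', [/\ finite_indices T M n k,
      finite_indices T (iter j T @` M) n' k' & (n + k' = n' + k)%N].
Proof.
move=> sM TM /fredholm_indices[n [k [Mn Mk]]].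
apply: index_iter => //; left; split; first by exists n.
elim: j => [|j IH]; first by rewrite image_id; exists k.
rewrite image_iterS; apply: fin_def_image => //; first exact: subspace_image_iter.
by rewrite -image_iterS image_iterSr; exact: image_subset.
Qed.

(** [W] plus the span of [g], in the form to which [closed_add_line] applies one
    vector at a time. *)
Definition extension n W (g : 'I_n -> X) : set X :=
  [set x | exists c : 'I_n -> R[i], W (x - \sum_(i < n) c i *: g i)].

Lemma extension_sub n W (g : 'I_n -> X) : subspace_set W -> subspace_set (extension W g).
Proof.
move=> sW; split.
  exists (fun=> 0); rewrite big1 ?subr0; first exact: subspace0.
  by move=> i _; rewrite scale0r.
move=> a x y [c Wc] [d Wd]; exists (fun i => a * c i + d i).
suff -> : a *: x + y - \sum_(i < n) (a * c i + d i) *: g i =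
    a *: (x - \sum_(i < n) c i *: g i) + (y - \sum_(i < n) d i *: g i) by case: sW => _; exact.
rewrite scalerBr addrACA -opprD scaler_sumr -big_split /=; congr (_ - _).
by apply: eq_bigr => i _; rewrite scalerDl scalerA.
Qed.

Lemma extension_closed n W (g : 'I_n -> X) :
  closed W -> subspace_set W -> closed (extension W g).
Proof.
move=> cW sW; elim: n g => [|n IH] g.
  suff -> : extension W g = W by [].
  apply/seteqP; split=> [x [c]|x Wx]; first by rewrite big_ord0 subr0.
  by exists (fun=> 0); rewrite big_ord0 subr0.
have -> : extension W g = [set x | exists c : R[i],
    extension W (fun i => g (widen_ord (leqnSn n) i)) (x - c *: g ord_max)].
  apply/seteqP; split=> x.
    move=> [c]; rewrite big_ord_recr /= opprD addrA addrAC => Wc.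
    by exists (c ord_max), (fun i => c (widen_ord (leqnSn n) i)).
  move=> [a [c Wc]]; exists (fun i => if unlift ord_max i is Some j then c j else a).
  rewrite big_ord_recr /= unlift_none opprD addrA addrAC.
  suff -> : \sum_(i < n) (if unlift ord_max (widen_ord (leqnSn n) i) is Some j
      then c j else a) *: g (widen_ord (leqnSn n) i) =
      \sum_(i < n) c i *: g (widen_ord (leqnSn n) i) by [].
  by apply: eq_bigr => i _; rewrite widen_ord_lift liftK.
by apply: closed_add_line => //; exact: extension_sub.
Qed.

(** The span of a basis modulo the range is a closed complement of the range. *)
Lemma closed_finite_codim_range A : closed A -> subspace_set A -> T @` A `<=` A ->
  fin_dim A (T @` A) -> closed (T @` A).
Proof.
move=> cA sA TA [n [e [eA ei eB]]].
have s0 := @subspace_set0 _ X.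
have sTA := subspace_image T sA.
apply: (@closed_complemented_range _ _ _ contT A (extension [set 0] e)) => //.
- by apply: extension_closed => //; exact: closed_set0.
- exact: extension_sub.
- suff -> : sumset (T @` A) (extension [set 0] e) = A by [].
  apply/seteqP; split=> [_ [x [y [TAx [c /= /subr0_eq ->] ->]]]|x Ax].
    apply: subspaceD => //; first exact: TA.
    by apply: subspace_sum => // i; exact: subspaceZ.
  have [c cB] := eB _ Ax.
  exists (x - \sum_(i < n) c i *: e i), (\sum_(i < n) c i *: e i).
  by split; [|exists c; rewrite /= subrr|rewrite subrK].
apply/seteqP; split=> [x [TAx [c /= /subr0_eq xE]]|_ ->].
  rewrite xE big1// => i _; rewrite (ei c) ?scale0r//; by rewrite -xE.
by split; [exact: subspace0|apply: subspace0; exact: extension_sub].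
Qed.

(** One step up the tower of ranges: lifting a basis of [W] modulo [T W] along [T]
    gives a subspace that [T] maps onto [W], and no kernel is added since the
    lifted vectors are independent modulo [T W] after applying [T]. *)
Lemma extension_step V W : subspace_set V -> closed W -> subspace_set W ->
  T @` W `<=` W -> fin_dim W (T @` W) -> W `<=` V -> W `<=` T @` V ->
  exists W', [/\ closed W', subspace_set W', W' `<=` V, T @` W' = W
    & [/\ W `<=` W', ker_on T W' `<=` W & fin_dim W' (T @` W')]].
Proof.
move=> sV cW sW TW [n [f [fW fi fB]]] WV WTV.
have /choice[g gP] : forall i, exists y, V y /\ T y = f i.
  by move=> i; have [y] := WTV _ (fW i); exists y.
have Tg (c : 'I_n -> R[i]) : T (\sum_(i < n) c i *: g i) = \sum_(i < n) c i *: f i.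
  by rewrite linear_sum; apply: eq_bigr => i _; rewrite linearZ/= (gP i).2.
have WW' : W `<=` extension W g.
  move=> x Wx; exists (fun=> 0).
  by rewrite big1 ?subr0// => i _; rewrite scale0r.
have TW' : T @` extension W g = W.
  apply/seteqP; split=> [_ [x [c Wc] <-]|x /[dup] Wx /fB[c [w Ww wE]]].
    rewrite -(subrK (\sum_(i < n) c i *: g i) x) linearD Tg; apply: subspaceD => //.
      by apply: TW; exists (x - \sum_(i < n) c i *: g i).
    by apply: subspace_sum => // i; exact: subspaceZ.
  exists (w + \sum_(i < n) c i *: g i); first by exists c; rewrite addrK.
  by rewrite linearD wE Tg subrK.
exists (extension W g); split=> //.
- exact: extension_closed.
- exact: extension_sub.
- move=> x [c Wc]; rewrite -(subrK (\sum_(i < n) c i *: g i) x); apply: subspaceD => //.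
    exact: WV.
  by apply: subspace_sum => // i; apply: subspaceZ => //; have [] := gP i.
split=> //.
  move=> x [[c Wc] Tx].
  have c0 : forall i, c i = 0.
    apply: fi; rewrite -Tg; exists (- (x - \sum_(i < n) c i *: g i)).
      exact: subspaceN.
    by rewrite opprB linearB Tx subr0.
  by move: Wc; rewrite big1 ?subr0// => i _; rewrite c0 scale0r.
exists n, g; rewrite TW'; split=> // [i|c Wc].
  exists (fun j => (j == i)%:R).
  rewrite (bigD1 i)//= eqxx scale1r big1 ?addr0 ?subrr; first exact: subspace0.
  by move=> j /negbTE ->; rewrite scale0r.
by apply: fi; rewrite -Tg; exists (\sum_(i < n) c i *: g i).
Qed.

(** [extension_step] is iterated through the ranges of the lower and lower powers
    of [T]. The kernel never grows, so it keeps lying in all the ranges, and those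
    of the powers of [T] on [M] catch up with them after [d] steps. *)
Lemma semi_regular_part d : let W := range (iter d T) in
  closed W -> fin_dim W (T @` W) -> (forall k, ker_on T W `<=` range (iter k T)) ->
  exists M, [/\ closed M, subspace_set M, T @` M `<=` M, semi_regular T M
    & [/\ iter d T @` M = W, ker_on T M `<=` W & fin_dim M (T @` M)]].
Proof.
move=> W cW fW kW.
have sW : subspace_set W by exact: (subspace_image_iter T d (@subspace_setT _ X)).
have TW : T @` W `<=` W by rewrite -image_iterS image_iterSr; exact: image_subset.
have H j : (j <= d)%N -> exists M, [/\ closed M, subspace_set M,
     T @` M `<=` M, M `<=` range (iter (d - j) T) & W `<=` M] /\
    [/\ iter j T @` M = W, ker_on T M `<=` W & fin_dim M (T @` M)].
  elim: j => [_|j IH jd].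
    by exists W; rewrite subn0 image_id; split; split=> // x [].
  have [M [[cM sM TM MV WM] [TjM kM fM]]] := IH (ltnW jd).
  have sV := subspace_image_iter T (d - j.+1) (@subspace_setT _ X).
  have [||M' [cM' sM' M'V TM' [MM' kM' fM']]] := extension_step sV cM sM TM fM.
  - apply: (subset_trans MV); have -> : (d - j = (d - j.+1).+1)%N by rewrite subnSK.
    by rewrite image_iterSr; exact: image_subset.
  - by rewrite -image_iterS subnSK.
  exists M'; split; split=> //.
  - by rewrite TM'.
  - exact: (subset_trans WM).
  - by rewrite image_iterSr TM'.
  - by move=> x kx; apply: kM; split; [exact: kM'|case: kx].
have [M [[cM sM TM _ WM] [TdM kM fM]]] := H _ (leqnn d).
exists M; split=> //; split; first exact: closed_finite_codim_range.
move=> x kx k _; have [dk|kd] := leqP d k.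
  have [y _ yx] := kW (k - d + d + d)%N x (conj (kM _ kx) kx.2).
  rewrite /= -(subnK dk); exists (iter d T y); first by apply: WM; exists y.
  by rewrite -iterD yx.
have : W x by exact: kM.
rewrite -TdM -(subnKC (ltnW kd)) => -[y My <-]; exists (iter (d - k) T y).
  by apply: (invariant_iter (n := (d - k)%N) TM); exists y.
by rewrite -iterD.
Qed.

(** On the kernel of [T ^ d] the operator is nilpotent, and the part of it in [M]
    is a free, hence injective, module over the algebra of truncated polynomials
    in [T]; a complement consists of the vectors whose whole orbit is killed by
    a projection onto [ker T `&` M]. *)
Lemma nilpotent_complement d M : closed M -> subspace_set M -> T @` M `<=` M ->
  semi_regular T M -> iter d T @` M = range (iter d T) ->
  fin_dim (ker_on T M) [set 0] ->
  exists N, Red T setT M N /\ nilpotent_on T N.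
Proof.
move=> cM sM TM srM TdM [n [e [eK ei eB]]].
have [P [cP PS PK]] := finite_projection e.
have sK := subspace_ker T sM.
have PKx x : ker_on T M x -> P x = x.
  by move=> /eB[c /= /subr0_eq ->]; exact: PK.
have KP x : ker_on T M (P x).
  by have [c ->] := PS x; apply: subspace_sum => // i; exact: subspaceZ.
pose N := [set x | iter d T x = 0 /\ forall i, P (iter i T x) = 0].
have [D D0 HD] := (continuous_nrmP P).1 cP.
have sN : subspace_set N.
  split; first by split=> [|i]; rewrite !linear0.
  by move=> a x y [x0 Px] [y0 Py]; split=> [|i]; rewrite !linearP /= ?x0 ?y0 ?Px ?Py scaler0 addr0.
exists N; split; last by exists d => x [].
split.
- by split.
- split=> //.
  + apply/closed_nrmP => x xN.
    have lim0 (f : {linear X -> X}) (C : R) : 0 < C -> (forall z, nrm (f z) <= C * nrm z) ->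
        (forall z, N z -> f z = 0) -> f x = 0.
      move=> C0 fC fN; apply/nrm_eq0/eqP; rewrite eq_le nrm_ge0 andbT.
      apply/ler_addgt0Pr => r r0; have [|z Nz xz] := xN (r / C); first by rewrite divr_gt0.
      rewrite add0r -[f x]subr0 -(fN _ Nz) -linearB (le_trans (fC _))//.
      by rewrite mulrC -ler_pdivlMr// ltW.
    split=> [|i].
      by have [C C0 HC] := iter_bounded d; apply: (lim0 (iter d T) C C0 HC) => z [].
    have [C C0 HC] := iter_bounded i.
    apply: (lim0 (P \o iter i T) (D * C)); first exact: mulr_gt0.
      move=> z; apply: (le_trans (HD _)); rewrite -mulrA.
      by apply: ler_wpM2l; [exact: ltW|exact: HC].
    by move=> z [_ Pz]; exact: Pz.
  + move=> _ [x [x0 Px] <-]; split=> [|i]; last by rewrite -iterSr.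
    by rewrite -iterSr iterS x0 linear0.
- apply/seteqP; split=> [x [Mx [x0 Px]]|_ ->]; last by split; exact: subspace0.
  have : forall j, (j <= d)%N -> iter (d - j) T x = 0.
    elim=> [|j IH] jd; first by rewrite subn0.
    (* the vector lies in [ker T `&` M], where [P] is the identity *)
    rewrite -(PKx (iter (d - j.+1) T x)) ?Px//; split.
      by apply: (invariant_iter (n := (d - j.+1)%N) TM); exists x.
    by rewrite -iterS subnSK// IH// ltnW.
  by move=> /(_ d (leqnn d)); rewrite subnn.
- move=> x _; have [m Mm mx] : (iter d T @` M) (iter d T x) by rewrite TdM; exists x.
  pose v := x - m; have v0 : iter d T v = 0 by rewrite /v linearB /= mx subrr.
  suff [y [My y0 Py]] : exists y, [/\ M y, iter d T y = 0
      & forall i, P (iter i T (v - y)) = 0].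
    exists (m + y), (v - y); split; first exact: subspaceD.
      by split=> //; rewrite linearB /= v0 y0 subrr.
    by rewrite /v addrACA subrr addr0 addrC subrK.
  have H j : (j <= d)%N -> exists y, [/\ M y, iter d T y = 0
      & forall i, (d - j <= i)%N -> P (iter i T (v - y)) = 0].
    elim: j => [_|j IH jd].
      exists 0; split; [exact: subspace0|by rewrite linear0|move=> i; rewrite subn0 subr0 => di].
      by rewrite -(subnK di) iterD v0 !linear0.
    have [y [My y0 Py]] := IH (ltnW jd).
    set w := v - y in Py; set c := P (iter (d - j.+1) T w).
    (* the projection of the orbit at time [d - j - 1] is cancelled by a vector
       whose orbit is zero at all later times *)
    have [_ kM] := srM; have [u Mu uc] := kM c (KP _) d.-1 I.
    have Tdu : iter d T u = 0.
      by rewrite -(ltn_predK jd) iterS /= uc; have [] := KP (iter (d - j.+1) T w).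
    exists (y + iter j T u); split.
    - by apply: subspaceD => //; apply: (invariant_iter (n := j) TM); exists u.
    - by rewrite linearD /= y0 add0r -iterD addnC iterD Tdu linear0.
    have PB i : P (iter i T (v - (y + iter j T u))) =
        P (iter i T w) - P (iter i T (iter j T u)).
      by rewrite opprD addrA -/w linearB /= linearB.
    move=> i; rewrite leq_eqVlt PB => /predU1P[<-|di].
      rewrite -/c -iterD.
      have -> : (d - j.+1 + j = d.-1)%N by lia.
      by rewrite uc (PKx c (KP _)) subrr.
    rewrite Py; last by move: di; rewrite subnSK.
    have -> : iter i T (iter j T u) = 0; last by rewrite linear0 subr0.
    rewrite -iterD; have dij : (d <= i + j)%N by move: di; lia.
    by rewrite -(subnK dij) iterD Tdu linear0.
  have [y [My y0 Py]] := H d (leqnn d); exists y; split=> // i.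
  by apply: Py; rewrite subnn.
Qed.

End SemiRegular.

(** * B-Fredholm operators and their decompositions *)

Section BFredholm.
Variables (R : realType) (X : completeNormedModType R[i]) (T : {linear X -> X}).
Hypothesis contT : continuous T.
Implicit Types (x y z : X) (A B C U V W M N Y : set X).

(** The kernels decrease with [k], and so do their dimensions; where these reach
    their minimum, the inclusions are equalities. *)
Lemma stationary_kernel n : fin_dim (ker_on T (range (iter n T))) [set 0] ->
  exists2 d, (n <= d)%N & forall k, (d <= k)%N ->
    ker_on T (range (iter d T)) `<=` range (iter k T).
Proof.
move=> fn; have s0 := @subspace_set0 _ X.
pose K k := ker_on T (range (iter k T)).
have sK k : subspace_set (K k) by apply: subspace_ker; apply: subspace_image_iter.
have decr j k : (j <= k)%N -> K k `<=` K j.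
  move=> jk _ [[x _ <-] Tx]; split=> //; exists (iter (k - j) T x) => //.
  by rewrite -iterD subnKC.
have fK k : (n <= k)%N -> fin_dim (K k) [set 0].
  by move=> nk; apply: (fin_dim_sub s0 _ fn); exact: decr.
pose P m := `[< exists2 k, (n <= k)%N & has_dim (K k) [set 0] m >].
have exP : exists m, P m by have [m] := fK n (leqnn n); exists m; apply/asboolP; exists n.
case: (ex_minnP exP) => m /asboolP[d nd Kd] mmin; exists d => // k dk.
have [m' Kk] := fK k (leq_trans nd dk).
have [j Kdk] : fin_dim (K d) (K k).
  by apply: (fin_dim_quo s0 (sK k) _ (fK d nd)) => _ ->; exact: subspace0.
have mE : m = (m' + j)%N.
  apply: (has_dim_uniq s0 Kd); apply: (has_dim_add s0 (sK k)) => //.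
    by move=> _ ->; exact: subspace0.
  exact: decr.
have j0 : j = 0%N.
  have : (m <= m')%N by apply: mmin; apply/asboolP; exists k => //; exact: leq_trans dk.
  by lia.
rewrite j0 in Kdk; move/(has_dim0 _ (sK k)) : Kdk => Kdk x Kx.
by have [] := Kdk _ Kx.
Qed.

Lemma bfredholm_ranges n k : closed (range (iter n T)) ->
  fin_dim (range (iter n T)) (T @` range (iter n T)) -> (n <= k)%N ->
  closed (range (iter k T)) /\ fin_dim (range (iter k T)) (T @` range (iter k T)).
Proof.
move=> cn fn /subnK <-; elim: (k - n)%N => [|j [cj fj]]; first by rewrite add0n.
have sj := subspace_image_iter T (j + n) (@subspace_setT _ X).
have Tj : T @` range (iter (j + n) T) `<=` range (iter (j + n) T).
  by rewrite -image_iterS image_iterSr; exact: image_subset.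
rewrite addSn image_iterS; split; first exact: closed_finite_codim_range.
exact: fin_def_image.
Qed.

(** The rank [d] from which on the kernels are stationary also bounds the order of
    nilpotency of [T] on [N]. *)
Lemma bfredholm_decomposition : bfredholm T setT -> exists M N,
  [/\ Red T setT M N, fredholm T M, semi_regular T M & nilpotent_on T N].
Proof.
move=> [n [cn /fredholm_indices[a [b [na nb]]]]].
have [|d nd kd] := @stationary_kernel n; first by exists a.
have fn : fin_dim (range (iter n T)) (T @` range (iter n T)) by exists b.
have [cd fd] := bfredholm_ranges cn fn nd.
have [|M [cM sM TM srM [TdM kM fM]]] := semi_regular_part contT cd fd.
  move=> k x kx; have [dk|kd'] := leqP d k; first exact: kd kx.
  have [[y _ <-] _] := kx; exists (iter (d - k) T y) => //.
  by rewrite -iterD subnKC// ltnW.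
have fK : fin_dim (ker_on T M) [set 0].
  apply: (fin_dim_sub (@subspace_set0 _ X) _ (ex_intro _ a na)) => x kx.
  split; last by case: kx.
  have [y _ <-] := kM _ kx; exists (iter (d - n) T y) => //.
  by rewrite -iterD subnKC.
have [N [redMN nN]] := nilpotent_complement contT cM sM TM srM TdM fK.
exists M, N; split=> //.
have [p Kp] := fK; have [q Mq] := fM.
exact: (@finite_indices_fredholm _ _ _ _ p q).
Qed.

Lemma Red_sub Y M N : Red T Y M N ->
  [/\ subspace_set M, subspace_set N, T @` M `<=` M & T @` N `<=` N].
Proof. by move=> [[? ? ? ?] [? ? ? ?]]. Qed.

Lemma Red_subset Y M N : Red T Y M N -> M `<=` Y /\ N `<=` Y.
Proof. by move=> [[? ? ? ?] [? ? ? ?]]. Qed.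

Lemma Red_sumset Y M N : subspace_set Y -> Red T Y M N -> sumset M N = Y.
Proof.
move=> sY [[_ _ MY _] [_ _ NY _] _ YMN]; apply/seteqP; split=> [_ [x [y [Mx Ny ->]]]|x /YMN//].
by apply: subspaceD => //; [exact: MY|exact: NY].
Qed.

Lemma Red_uniq Y M N a a' b b' : Red T Y M N -> M a -> M a' -> N b -> N b' ->
  a + b = a' + b' -> a = a' /\ b = b'.
Proof.
move=> redMN Ma Ma' Nb Nb' E; have [sM sN _ _] := Red_sub redMN.
have [_ _ MN0 _] := redMN.
have aE : a - a' = b' - b.
  by apply: (addIr b); rewrite subrK addrAC E addrC addKr.
have a0 : a - a' = 0.
  have : (M `&` N) (a - a') by split; [exact: subspaceB|rewrite aE; exact: subspaceB].
  by rewrite MN0.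
by split; apply/subr0_eq => //; rewrite -opprB -aE a0 oppr0.
Qed.

Lemma invariant_iter_mem A k x : T @` A `<=` A -> A x -> A (iter k T x).
Proof. by move=> TA Ax; apply: (invariant_iter (n := k) TA); exists x. Qed.

Lemma nilpotent_range d Y M N k : subspace_set Y -> Red T Y M N ->
  (forall x, N x -> iter d T x = 0) -> (d <= k)%N ->
  iter k T @` Y = iter k T @` M.
Proof.
move=> sY redMN Nd dk; have [MY _] := Red_subset redMN.
apply/seteqP; split; last exact: image_subset.
rewrite -(Red_sumset sY redMN) => _ [_ [x [y [Mx Ny ->]]] <-]; exists x => //.
by rewrite linearD /= -{3}(subnK dk) iterD (Nd _ Ny) linear0 addr0.
Qed.

Lemma decomposition_bfredholm M N : Red T setT M N -> fredholm T M ->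
  semi_regular T M -> nilpotent_on T N -> bfredholm T setT.
Proof.
move=> redMN fM srM [d Nd]; have [sM sN TM TN] := Red_sub redMN.
have cM : closed M by case: redMN => [[]].
exists d; rewrite (nilpotent_range (@subspace_setT _ X) redMN Nd (leqnn d)).
split; first exact: semi_regular_closed_iter.
have [_ [_ [n [k [_ fnk _]]]]] := fredholm_iter d sM TM fM.
exact: finite_indices_fredholm (subspace_image_iter T d sM) fnk.
Qed.

End BFredholm.

(** * Quasi-nilpotent operators *)

Section QuasiNilpotent.
Variables (R : realType) (X : completeNormedModType R[i]) (T : {linear X -> X}).
Hypothesis contT : continuous T.
Implicit Types (x y z : X) (A B C U V W M N Y Z : set X) (l : R[i]).

(** Partial sums of the Neumann series of the inverse of [T - l]. *)
Fixpoint neumann l n x : X :=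
  if n is m.+1 then neumann l m x - (l^-1 ^+ m.+1) *: iter m T x else 0.

Lemma neumann_linear l n : linear (neumann l n).
Proof.
move=> a x y; elim: n => [|n IH] /=; first by rewrite scaler0 addr0.
rewrite IH linearP /= scalerDr opprD addrACA; congr (_ + _).
by rewrite scalerBr !scalerA mulrC.
Qed.

HB.instance Definition _ l n :=
  GRing.isLinear.Build R[i] X X *:%R (neumann l n) (neumann_linear l n).

Lemma neumann_continuous l n : continuous (neumann l n).
Proof.
apply/continuous_nrmP; elim: n => [|n [C C0 HC]].
  by exists 1 => // x; rewrite /= nrm0 mul1r nrm_ge0.
have [D D0 HD] := iter_bounded contT n; pose r := complex.Re `|l^-1 ^+ n.+1|.
have r0 : 0 <= r by rewrite -ler0c RRe_real ?normr_real.
exists (C + r * D); first by rewrite ltr_pwDl// mulr_ge0// ltW.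
move=> x; rewrite /= (le_trans (nrmD _ _))// nrmN mulrDl; apply: lerD; first exact: HC.
by rewrite nrmZ -mulrA; apply: ler_wpM2l => //; exact: HD.
Qed.

Lemma neumannE l n x : l != 0 ->
  T (neumann l n x) - l *: neumann l n x = x - (l^-1 ^+ n) *: iter n T x.
Proof.
move=> l0; elim: n => [|n IH] /=; first by rewrite linear0 scaler0 expr0 scale1r !subrr.
rewrite linearB linearZ/= scalerBr opprB addrA addrAC [T _ - _ - _]addrAC IH.
rewrite scalerA exprS mulrA mulfV// mul1r; set a := _ *: iter n T x.
by rewrite addrAC subrK.
Qed.

Lemma neumann_comm l n x : neumann l n (T x) = T (neumann l n x).
Proof.
elim: n => [|n IH] /=; first by rewrite linear0.
by rewrite IH [RHS]linearB; congr (_ - _); rewrite linearZ /= -iterSr.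
Qed.

Lemma neumann_stable l n N x : subspace_set N -> T @` N `<=` N -> N x ->
  N (neumann l n x).
Proof.
move=> sN TN Nx; elim: n => [|n IH] /=; first exact: subspace0.
by apply: subspaceB => //; apply: subspaceZ => //; exact: invariant_iter_mem.
Qed.

Lemma nilpotent_quasi_nilpotent N : subspace_set N -> T @` N `<=` N ->
  nilpotent_on T N -> quasi_nilpotent T N.
Proof.
move=> sN TN [n Nn]; have [N0|N0] := pselect (N `<=` [set 0]).
  by left; apply/seteqP; split=> // _ ->; exact: subspace0.
right; apply/seteqP; split=> [l lN|_ ->].
  apply: contrapT => /eqP l0; apply: lN; exists (neumann l n).
  have inv x : N x -> T (neumann l n x) - l *: neumann l n x = x.
    by move=> Nx; rewrite neumannE// Nn// scaler0 subr0.
  split=> //.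
  - by move=> x Nx; exact: neumann_stable.
  - by move=> a x y _ _; rewrite linearP.
  - by apply: continuous_subspaceT; exact: neumann_continuous.
  - by move=> x Nx; rewrite linearB linearZ /= neumann_comm inv.
move=> [S [_ SL _ SA _]]; apply: N0 => x Nx /=.
have S0 : S 0 = 0.
  have := SL 1 0 0 (subspace0 sN) (subspace0 sN); rewrite !scale1r addr0 => S00.
  by apply: (addrI (S 0)); rewrite addr0 -S00.
have inj y : N y -> T y = 0 -> y = 0.
  by move=> Ny Ty; rewrite -(SA y Ny) Ty scale0r subr0.
move: (Nn _ Nx); elim: n {Nn} => // n IH; rewrite iterS => /inj H.
by apply: IH; apply: H; exact: invariant_iter_mem.
Qed.

Lemma quasi_nilpotent_invertible N l : quasi_nilpotent T N -> N <> [set 0] ->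
  l != 0 -> invertible_on (fun x => T x - l *: x) N.
Proof.
move=> [//|spN] _ l0; apply: contrapT => ninv.
have : spectrum T N l by [].
by rewrite spN /= => /eqP; rewrite (negbTE l0).
Qed.

(** A kernel vector [x0] that lies in the range of every power of [T] starts a
    chain of preimages [x1, x2, ...] of geometric growth. For small nonzero [l]
    the partial sums of [\sum_i l ^ i x_i] stay away from [0] while [T - l] sends
    them to [0], against the continuity of the inverse of [T - l]. *)
Lemma hyperrange_injective N Z : Z `<=` N -> closed Z -> subspace_set Z ->
  T @` Z `<=` Z -> closed (T @` Z) -> (forall k, ker_on T Z `<=` iter k T @` Z) ->
  (forall l, l != 0 -> invertible_on (fun x => T x - l *: x) N) ->
  ker_on T Z `<=` [set 0].
Proof.
move=> ZN cZ sZ TZ cTZ hyp inv x0 [Zx0 Tx0] /=; apply: contrapT => x00.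
have n0 : 0 < nrm x0.
  by rewrite lt_def nrm_ge0 andbT; apply/eqP => /nrm_eq0.
have [C C0 op] := open_onto_range contT cZ sZ cTZ.
pose Q x := forall k, (iter k T @` Z) x.
have step x : exists y, Q x -> [/\ Q y, T y = x & nrm y <= C * nrm x].
  have [Qx|nQ] := pselect (Q x); last by exists 0.
  have [y [Zy Tyx ny]] := op x (Qx 1); exists y => _; split=> // k.
  have [z Zz zx] := Qx k.+1; have sI := subspace_image_iter T k sZ.
  rewrite -(subrK (iter k T z) y); apply: subspaceD => //; apply: hyp; split.
    by apply: subspaceB => //; exact: invariant_iter_mem.
  by rewrite linearB Tyx -iterS zx subrr.
have [g gP] := choice step.
pose s n := iter n g x0.
have Qs n : Q (s n).
  elim: n => [|n IH] /=; first by move=> k; apply: hyp.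
  by have [] := gP _ IH.
have Zs k : Z (s k) by have [z Zz <-] := Qs k 0.
have sT n : T (s n.+1) = s n by have [] := gP _ (Qs n).
have sn n : nrm (s n) <= C ^+ n * nrm x0.
  elim: n => [|n IH]; first by rewrite mul1r.
  have [_ _] := gP _ (Qs n); move/le_trans; apply.
  by rewrite exprS -mulrA ler_pM2l.
(* with this [l] the terms decrease like [4 ^ - i], and [x0] dominates the sum *)
pose r := (4 * C)^-1; have r0 : 0 < r by rewrite invr_gt0 mulr_gt0.
pose l := r%:C.
have l0 : l != 0 := complexr_neq0 r0.
pose h : R := 2^-1; have h0 : 0 < h by rewrite invr_gt0.
have h1 : h + h = 1 by rewrite -mulr2n -mulr_natl mulfV.
have tn n : nrm (l ^+ n *: s n) <= h ^+ n * h ^+ n * nrm x0.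
  rewrite /l -rmorphXn nrmZr ger0_norm; last by rewrite exprn_ge0// ltW.
  have -> : h ^+ n * h ^+ n = r ^+ n * C ^+ n.
    by rewrite -!exprMn /r /h; congr (_ ^+ n); rewrite invfM mulfVK ?gt_eqF// -invfM -natrM.
  by rewrite -mulrA ler_wpM2l// exprn_ge0// ltW.
pose y := fix y n := if n is m.+1 then y m + l ^+ m.+1 *: s m.+1 else x0.
have Zy n : Z (y n).
  by elim: n => [|n IH] //=; apply: subspaceD => //; apply: subspaceZ => //; exact: (Zs n.+1).
(* telescoping: only the last term survives *)
have yE n : T (y n) - l *: y n = - (l ^+ n.+1 *: s n).
  elim: n => [|n IH] /=; first by rewrite Tx0 sub0r expr1.
  rewrite linearD linearZ/= sT scalerDr opprD addrACA IH scalerA -exprS.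
  by rewrite addrA addNr sub0r.
have yn n : nrm (y n - x0) <= (h - h ^+ n.+1) * nrm x0.
  elim: n => [|n IH]; first by rewrite subrr nrm0 expr1 subrr mul0r.
  rewrite /= addrAC (le_trans (nrmD _ _))//.
  have := tn n.+1; rewrite !exprS in IH *.
  have : h ^+ n <= 1 by rewrite exprn_ile1 ?ltW// -h1 ltrDl.
  have : 0 < h ^+ n by rewrite exprn_gt0.
  move: IH; set a := h ^+ n => IH a0 a1 N2.
  have : a * a * nrm x0 <= a * nrm x0 by rewrite ler_pM2r// ger_pMl.
  by move: IH N2; rewrite /h; lra.
have [S [_ SL cS SA _]] := inv l l0.
have sN0 : N 0 by apply: ZN; exact: subspace0.
have S0 : S 0 = 0.
  have := SL 1 0 0 sN0 sN0; rewrite !scale1r addr0 => S00.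
  by apply: (addrI (S 0)); rewrite addr0 -S00.
have /(cS (0 : X)) : nbhs (S 0) [set z | nrm z < h * nrm x0].
  rewrite S0; apply/nbhs_nrmP; exists (h * nrm x0); first exact: mulr_gt0.
  by move=> z; rewrite sub0r nrmN.
rewrite /nbhs /= -nbhs_subspace_in// => /nbhs_nrmP[e e0 He].
have [n ne] : exists n, r * nrm x0 * h ^+ n < e.
  by apply: geometric_small => //; rewrite mulr_ge0 ?ltW.
have : nrm (S (T (y n) - l *: y n)) < h * nrm x0.
  apply: He; last first.
    by apply: ZN; apply: (subspaceB sZ); [apply: TZ; exists (y n)|exact: subspaceZ].
  rewrite sub0r nrmN yE nrmN (le_lt_trans _ ne)//.
  rewrite exprS -scalerA nrmZr gtr0_norm// -mulrA ler_pM2l// (le_trans (tn n))//.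
  rewrite [leRHS]mulrC ler_pM2r// ger_pMl ?exprn_gt0// exprn_ile1 ?ltW//.
  by rewrite -h1 ltrDl.
rewrite SA; last exact: ZN.
have := nrmD (x0 - y n) (y n); rewrite subrK nrmB; have := yn n.
have : 0 <= h ^+ n.+1 * nrm x0 by rewrite mulr_ge0 ?nrm_ge0// exprn_ge0// ltW.
have : nrm x0 = h * nrm x0 + h * nrm x0 by rewrite -mulrDl h1 mul1r.
by rewrite mulrBl; lra.
Qed.

(** On [Z] the solutions [x] of [T x - l x = z] stay bounded as [l] tends to [0],
    because [T] is bounded below there; hence [T x] tends to [z]. *)
Lemma hyperrange_surjective N Z d : subspace_set N -> T @` N `<=` N ->
  Z = iter d T @` N -> closed Z -> closed (T @` Z) -> ker_on T Z `<=` [set 0] ->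
  (forall l, l != 0 -> invertible_on (fun x => T x - l *: x) N) -> Z `<=` T @` Z.
Proof.
move=> sN TN ZE cZ cTZ inj inv z Zz.
have sZ : subspace_set Z by rewrite ZE; exact: subspace_image_iter.
have [C C0 HC] := injective_bounded_below contT cZ sZ cTZ inj.
move/closed_nrmP: cTZ; apply => e e0.
have z1 : 0 < nrm z + 1 by rewrite ltr_wpDl// nrm_ge0.
pose r := Num.min (2 * C)^-1 (e / (2 * C * (nrm z + 1))).
have r0 : 0 < r by rewrite lt_min invr_gt0 divr_gt0// !mulr_gt0.
pose l := r%:C.
have l0 : l != 0 := complexr_neq0 r0.
have [S [SN _ _ _ AS]] := inv l l0.
move: (Zz); rewrite {1}ZE => -[n Nn nz].
pose x := iter d T (S n); have Zx : Z x by rewrite ZE; exists (S n) => //; exact: SN.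
have xz : T x - l *: x = z.
  by rewrite -nz -[in RHS](AS n Nn) [RHS]linearB; congr (_ - _); rewrite ?linearZ //= -iterSr.
exists (T x); first by exists x.
have -> : z - T x = - (l *: x) by rewrite -xz addrAC subrr sub0r.
have nlx : nrm (l *: x) = r * nrm x by rewrite nrmZr gtr0_norm.
rewrite nrmN nlx.
have nx : nrm x <= C * (nrm z + r * nrm x).
  rewrite (le_trans (HC x Zx))// ler_pM2l// -nlx.
  by rewrite -{1}(subrK (l *: x) (T x)) xz nrmD.
have rC : r * (2 * C) <= 1 by rewrite -ler_pdivlMr ?mulr_gt0// mul1r ge_min lexx.
have re : r * (2 * C * (nrm z + 1)) <= e.
  by rewrite -ler_pdivlMr ?mulr_gt0// ge_min lexx orbT.
have nx2 : nrm x <= 2 * C * nrm z.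
  have := ler_wpM2r (nrm_ge0 x) rC; move: nx; set m := nrm x.
  by lra.
rewrite (lt_le_trans _ re)// ltr_pM2l// (le_lt_trans nx2)// ltr_pM2l ?mulr_gt0//.
by rewrite ltrDl.
Qed.

End QuasiNilpotent.

(** * Comparison of two decompositions *)

Section Uniqueness.
Variables (R : realType) (X : completeNormedModType R[i]) (T : {linear X -> X}).
Hypothesis contT : continuous T.
Implicit Types (x y z : X) (A B C U V W Z : set X).

Lemma image_Red Y M N k : subspace_set Y -> Red T Y M N ->
  iter k T @` Y = sumset (iter k T @` M) (iter k T @` N).
Proof.
move=> sY redMN; rewrite -(Red_sumset sY redMN); apply/seteqP; split.
  move=> _ [_ [x [y [Mx Ny ->]]] <-]; exists (iter k T x), (iter k T y).
  by split; [exists x|exists y|rewrite linearD].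
move=> _ [_ [_ [[x Mx <-] [y Ny <-] ->]]]; exists (x + y); last by rewrite linearD.
by exists x, y.
Qed.

(** Projections along a reduction commute with [T]. *)
Lemma image_summand Y M N k : subspace_set Y -> Red T Y M N ->
  iter k T @` N = N `&` iter k T @` Y.
Proof.
move=> sY redMN; have [sM sN TM TN] := Red_sub redMN; apply/seteqP; split.
  move=> _ [x Nx <-]; split; first exact: invariant_iter_mem.
  by have [_ NY] := Red_subset redMN; exists x => //; exact: NY.
move=> x [Nx]; rewrite (image_Red k sY redMN) => -[_ [_ [[a Ma <-] [b Nb <-] xE]]].
have [_ ->] := Red_uniq redMN (subspace0 sM) (invariant_iter_mem k TM Ma) Nx
  (invariant_iter_mem k TN Nb) (etrans (add0r _) xE).
by exists b.
Qed.

Variables (Y M N M' N' : set X) (d : nat).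
Hypotheses (sY : subspace_set Y) (redMN : Red T Y M N) (srM : semi_regular T M)
  (Nd : forall x, N x -> iter d T x = 0)
  (redMN' : Red T Y M' N') (qN' : quasi_nilpotent T N').

Let Z := iter d T @` N'.

Let sM : subspace_set M. Proof. by have [] := Red_sub redMN. Qed.
Let sN : subspace_set N. Proof. by have [] := Red_sub redMN. Qed.
Let TM : T @` M `<=` M. Proof. by have [] := Red_sub redMN. Qed.
Let TN : T @` N `<=` N. Proof. by have [] := Red_sub redMN. Qed.
Let sM' : subspace_set M'. Proof. by have [] := Red_sub redMN'. Qed.
Let sN' : subspace_set N'. Proof. by have [] := Red_sub redMN'. Qed.
Let TM' : T @` M' `<=` M'. Proof. by have [] := Red_sub redMN'. Qed.
Let TN' : T @` N' `<=` N'. Proof. by have [] := Red_sub redMN'. Qed.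
Let cM : closed M. Proof. by case: redMN => [[]]. Qed.
Let cN' : closed N'. Proof. by case: redMN' => [_ []]. Qed.
Let sZ : subspace_set Z. Proof. exact: subspace_image_iter. Qed.
Let ZN' : Z `<=` N'. Proof. exact: invariant_iter. Qed.

Let rangeE k : (d <= k)%N -> iter k T @` Y = iter k T @` M.
Proof. exact: nilpotent_range sY redMN Nd. Qed.

Let Z_closed k : (d <= k)%N -> closed (iter k T @` N').
Proof.
move=> dk; rewrite (image_summand k sY redMN') rangeE//; apply: closedI => //.
exact: semi_regular_closed_iter.
Qed.

(** As [Z] is contained in [T ^ d M], the kernel of [T] on [Z] lies in the range of
    every power of [T]; the invertibility of [T - l] on [N'] for all nonzero [l]
    then passes to the limit [l = 0] on [Z]. *)
Lemma quasi_nilpotent_range_bijective : ker_on T Z `<=` [set 0] /\ T @` Z = Z.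
Proof.
have TZ : T @` Z `<=` Z.
  by rewrite /Z -image_iterS image_iterSr; exact: image_subset.
have [N'0|N'0] := pselect (N' = [set 0]).
  have Z0 : Z = [set 0] by rewrite /Z N'0 image_set1 linear0.
  by rewrite Z0; split; [move=> x []|rewrite image_set1 linear0].
have inv l l0 := quasi_nilpotent_invertible (l := l) qN' N'0 l0.
have cZ : closed Z by exact: Z_closed.
have cTZ : closed (T @` Z) by rewrite -image_iterS; exact: Z_closed.
have inj : ker_on T Z `<=` [set 0].
  apply: (hyperrange_injective contT ZN' cZ sZ TZ cTZ _ inv) => k x [Zx Tx].
  rewrite -image_iterD (image_summand (k + d) sY redMN'); split; first exact: ZN'.
  rewrite rangeE ?leq_addl//.
  have [y My yx] : (iter d T @` M) x.
    rewrite -rangeE//; have [y N'y yx] := Zx; exists y => //.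
    by have [_ N'Y] := Red_subset redMN'; exact: N'Y.
  have [_ kM] := srM; apply: kM => //; split=> //; rewrite -yx.
  by apply: invariant_iter_mem.
split=> //; apply/seteqP; split=> //.
exact: (hyperrange_surjective contT sN' TN' erefl).
Qed.

Let injZ : ker_on T Z `<=` [set 0].
Proof. by have [] := quasi_nilpotent_range_bijective. Qed.

Let surjZ : T @` Z = Z.
Proof. by have [] := quasi_nilpotent_range_bijective. Qed.

Let injZ_iter k x : Z x -> iter k T x = 0 -> x = 0.
Proof.
move=> Zx; elim: k => // k IH; rewrite iterS => Tx; apply: IH.
by apply: injZ; split=> //; apply: invariant_iter_mem => //; rewrite surjZ.
Qed.

(** Both indices are that of [T] on its range [T ^ d Y], which is [T ^ d M] and also
    the sum of [T ^ d M'] and [Z]; the bijective part [Z] does not affect it. *)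
Lemma index_decomposition_unique :
  fredholm T M -> fredholm T M' -> fred_index T M' = fred_index T M.
Proof.
move=> fM fM'.
have [n1 [k1 [n [k [F1 [nM kM] E1]]]]] := fredholm_iter d sM TM fM.
have [n2 [k2 [n' [k' [F2 [nM' kM'] E2]]]]] := fredholm_iter d sM' TM' fM'.
have sTM' := subspace_image_iter T d sM'.
have dE : iter d T @` M = sumset (iter d T @` M') Z.
  by rewrite -rangeE// (image_Red d sY redMN').
have TdE : T @` (iter d T @` M) = sumset (T @` (iter d T @` M')) Z.
  by rewrite -!image_iterS -rangeE// (image_Red _ sY redMN') !image_iterS -/Z surjZ.
have TdM' : iter d T @` M' `<=` M' by exact: invariant_iter.
have kerE : ker_on T (iter d T @` M) = ker_on T (iter d T @` M').
  rewrite dE; apply/seteqP; split=> [_ [[a [b [Ma Zb ->]]] Tab]|x [Mx Tx]].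
    have [Ta Tb] : T a = 0 /\ T b = 0.
      apply: (Red_uniq redMN').
      + by apply: TM'; exists a => //; exact: TdM'.
      + exact: subspace0.
      + by apply: TN'; exists b => //; exact: ZN'.
      + exact: subspace0.
      + by rewrite -linearD Tab addr0.
    have b0 : b = 0 by exact: injZ.
    by rewrite b0 addr0.
  by split=> //; exact: sumsetl.
have n'E : n = n' by apply: (has_dim_uniq (@subspace_set0 _ X) nM); rewrite kerE.
have k'E : k = k'.
  apply: (has_dim_uniq _ kM); first exact/subspace_image/subspace_image_iter.
  rewrite TdE dE; apply/has_dim_sumset => //; first exact: subspace_image.
    by rewrite -image_iterS image_iterSr; exact: image_subset.
  move=> x [Mx [a [b [TMa Zb xE]]]].
  have M'a : M' a.
    by apply: TM'; have [c Mc <-] := TMa; exists c => //; exact: TdM'.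
  by have [-> _] := Red_uniq redMN' (TdM' _ Mx) M'a (subspace0 sN') (ZN' Zb)
    (etrans (addr0 _) xE).
subst n' k'; rewrite (fred_indexE sM F1) (fred_indexE sM' F2); congr EFin.
have := congr1 (fun m => m%:R : R) E1; have := congr1 (fun m => m%:R : R) E2.
by rewrite !natrD; lra.
Qed.

Hypothesis srM' : semi_regular T M'.

(** A vector of the kernel of [T ^ k] on [M] lies in [T ^ d Y], so that its
    component along [N'] lies in [Z], where [T] is injective. *)
Lemma ker_iter_unique k : ker_on (iter k T) M = ker_on (iter k T) M'.
Proof.
have [MY _] := Red_subset redMN; have [M'Y _] := Red_subset redMN'.
apply/seteqP; split=> x kx; split; try by case: kx.
  have [_ Tx] := kx.
  have [y My yx] := semi_regular_ker_iter d sM TM srM kx.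
  have : (iter d T @` Y) x by exists y => //; exact: MY.
  rewrite (image_Red d sY redMN') => -[a [b [M'a Zb xE]]].
  have [Ta Tb] : iter k T a = 0 /\ iter k T b = 0.
    apply: (Red_uniq redMN'); [|exact: subspace0| |exact: subspace0|].
    - by apply: invariant_iter_mem => //; apply: (invariant_iter (n := d) TM').
    - by apply: invariant_iter_mem => //; exact: ZN'.
    - by rewrite -linearD -xE addr0.
  rewrite xE (injZ_iter Zb Tb) addr0.
  exact: (invariant_iter (n := d) TM').
have [y M'y yx] := semi_regular_ker_iter d sM' TM' srM' kx.
have : (iter d T @` Y) x by exists y => //; exact: M'Y.
by rewrite rangeE//; exact: invariant_iter.
Qed.

(** Both sides are [T Y + ker (T ^ d)]. *)
Lemma range_sum_unique : sumset (T @` M) N = sumset (T @` M') N'.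
Proof.
have [_ _ _ YM'N'] := redMN'; have [_ _ _ YMN] := redMN.
have [MY NY] := Red_subset redMN; have [M'Y N'Y] := Red_subset redMN'.
have sTM := subspace_image T sM; have sTM' := subspace_image T sM'.
have sMN : subspace_set (sumset (T @` M) N) by exact: subspace_sumset.
have sMN' : subspace_set (sumset (T @` M') N') by exact: subspace_sumset.
have rMN : T @` Y `<=` sumset (T @` M) N.
  move=> _ [y /YMN[a [b [Ma Nb ->]]] <-]; rewrite linearD.
  by exists (T a), (T b); split=> //; apply: TN; exists b.
have rMN' : T @` Y `<=` sumset (T @` M') N'.
  move=> _ [y /YM'N'[a [b [Ma Nb ->]]] <-]; rewrite linearD.
  by exists (T a), (T b); split=> //; apply: TN'; exists b.
have kMN : ker_on (iter d T) Y `<=` sumset (T @` M) N.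
  move=> _ [/YMN[a [b [Ma Nb ->]]]]; rewrite linearD /= (Nd Nb) addr0 => Ta.
  exists a, b; split=> //; exact: (semi_regular_ker_iter (j := d) 1 sM TM srM).
have kMN' : ker_on (iter d T) Y `<=` sumset (T @` M') N'.
  move=> _ [/YM'N'[a [b [Ma Nb ->]]]] Tab.
  have [Ta Tb] : iter d T a = 0 /\ iter d T b = 0.
    apply: (Red_uniq redMN'); [exact: invariant_iter_mem|exact: subspace0|
      exact: invariant_iter_mem|exact: subspace0|].
    by rewrite addr0 -[LHS](linearD (iter d T)).
  exists a, b; split=> //; exact: (semi_regular_ker_iter (j := d) 1 sM' TM' srM').
apply/seteqP; split=> _ [x [y [[z Mz <-] Ny ->]]]; apply: subspaceD => //.
- by apply: rMN'; exists z => //; exact: MY.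
- by apply: kMN'; split; [exact: NY|exact: Nd].
- by apply: rMN; exists z => //; exact: M'Y.
(* [N' = Z + ker (T ^ d)] as [T ^ d] maps [Z] onto itself *)
have [u Zu uy] : (iter d T @` Z) (iter d T y).
  have -> : iter d T @` Z = Z; last by exists y.
  by elim: d => [|k IH]; [rewrite image_id|rewrite image_iterS IH].
rewrite -(subrK u y); apply: subspaceD => //.
  apply: kMN; split; last by rewrite linearB /= uy subrr.
  by apply: N'Y; apply: subspaceB => //; exact: ZN'.
apply: rMN; rewrite -surjZ in Zu; have [w Zw <-] := Zu.
by exists w => //; exact/N'Y/ZN'.
Qed.

End Uniqueness.

Section Invariants.
Variables (R : realType) (X : completeNormedModType R[i]) (T : {linear X -> X}).
Hypothesis contT : continuous T.

Lemma deficiency_sumset Y M N : subspace_set Y -> Red T Y M N ->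
  deficiency T M = qdim Y (sumset (T @` M) N).
Proof.
move=> sY redMN; have [sM sN TM TN] := Red_sub redMN.
rewrite -[Y in RHS](Red_sumset sY redMN); apply: qdim_eq => n; apply: iff_sym.
apply: has_dim_sumset => //; first exact: subspace_image.
move=> x [Mx [a [b [TMa Nb xE]]]].
by have [-> _] := Red_uniq redMN Mx (TM _ TMa) (subspace0 sN) Nb (etrans (addr0 _) xE).
Qed.

Lemma range_full_sumset Y M N : subspace_set Y -> Red T Y M N ->
  T @` M = M <-> sumset (T @` M) N = Y.
Proof.
move=> sY redMN; have [sM sN TM TN] := Red_sub redMN.
split=> [->|E]; first exact: Red_sumset sY redMN.
apply/seteqP; split=> // x Mx.
have : Y x by have [MY _] := Red_subset redMN; exact: MY.
rewrite -E => -[a [b [TMa Nb xE]]].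
by have [-> _] := Red_uniq redMN Mx (TM _ TMa) (subspace0 sN) Nb (etrans (addr0 _) xE).
Qed.

(** The descent of a semi-regular operator is [0] or [+oo]: since the kernels of
    the powers lie in the range, equality of two ranges pulls back along [T]. *)
Lemma semi_regular_descentP M k : subspace_set M -> T @` M `<=` M ->
  semi_regular T M ->
  (forall m, (k <= m)%N -> iter k T @` M = iter m T @` M) <-> T @` M = M.
Proof.
move=> sM TM srM; split=> [H|TMM m _]; last first.
  have E j : iter j T @` M = M by elim: j => [|j IH]; rewrite ?image_id// image_iterS IH.
  by rewrite !E.
apply/seteqP; split=> // x Mx.
have [y My yx] : (iter k.+1 T @` M) (iter k T x) by rewrite -H//; exists x.
rewrite -(subrK (T y) x); apply: subspaceD; first exact: subspace_image.
  apply: (semi_regular_ker_iter 1 sM TM srM (j := k)); split.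
    by apply: subspaceB => //; apply: TM; exists y.
  by rewrite linearB /= -yx iterSr subrr.
by exists y.
Qed.

Lemma pf_value_unique f Y M N : subspace_set Y -> Red T Y M N -> semi_regular T M ->
  nilpotent_on T N ->
  (forall M' N', pseudo_fredholm_pair T Y M' N' -> f M' = f M) ->
  pf_value f T Y = f M.
Proof.
move=> sY redMN srM nN fE; have [sM sN TM TN] := Red_sub redMN.
apply: xget_unique => [|_ [M' [N' pM'] <-]]; last exact: fE pM'.
by exists M => //; exists N; split=> //; exact: nilpotent_quasi_nilpotent.
Qed.

(** The deficiency and the descent depend only on [T M + N], and the nullity and the
    ascent only on the kernels of the powers of [T]. *)
Lemma pf_values Y M N : subspace_set Y -> Red T Y M N -> semi_regular T M ->
  nilpotent_on T N ->
  [/\ alpha T Y = nullity T M, beta T Y = deficiency T M,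
      pf_ascent T Y = ascent T M & pf_descent T Y = descent T M].
Proof.
move=> sY redMN srM nN; have [d Nd] := nN; have [sM sN TM TN] := Red_sub redMN.
split; apply: (pf_value_unique sY redMN srM nN) => M' N' [redMN' srM' qN'];
  have [sM' sN' TM' TN'] := Red_sub redMN'.
- rewrite /nullity; congr (vdim _).
  exact/esym/(ker_iter_unique contT sY redMN srM Nd redMN' qN' srM' 1).
- rewrite (deficiency_sumset sY redMN') (deficiency_sumset sY redMN).
  by rewrite (range_sum_unique contT sY redMN srM Nd redMN' qN' srM').
- rewrite /ascent; congr (inf_nat R _); apply/seteqP.
  split=> k /= H m km; have := H m km;
  by rewrite !(ker_iter_unique contT sY redMN srM Nd redMN' qN' srM').
- rewrite /descent; congr (inf_nat R _); apply/seteqP.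
  have E : T @` M' = M' <-> T @` M = M.
    rewrite (range_full_sumset sY redMN') (range_full_sumset sY redMN).
    by rewrite (range_sum_unique contT sY redMN srM Nd redMN' qN' srM').
  by split=> k /(semi_regular_descentP _ _ _ _) H; apply/semi_regular_descentP => //;
    apply/E; exact: H.
Qed.

(** The range of [T ^ (d + n)] is that of its restriction to [M]. *)
Lemma index_power_range M N n : Red T setT M N -> fredholm T M -> nilpotent_on T N ->
  semi_fredholm T (range (iter n T)) ->
  fred_index T M = fred_index T (range (iter n T)).
Proof.
move=> redMN fM [d Nd] sf; have [sM sN TM TN] := Red_sub redMN.
have sT := @subspace_setT _ X.
have sA := subspace_image_iter T n sT.
have TA : T @` range (iter n T) `<=` range (iter n T).
  by rewrite -image_iterS image_iterSr; exact: image_subset.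
have [n1 [k1 [n2 [k2 [F1 [nM kM] E1]]]]] := fredholm_iter (d + n) sM TM fM.
have AE : iter d T @` range (iter n T) = iter (d + n) T @` M.
  by rewrite -image_iterD (nilpotent_range sT redMN Nd)// leq_addr.
have [|n3 [k3 [n4 [k4 [F3 [nA kA] E3]]]]] := index_iter (j := d) sA TA.
  rewrite AE; case: sf => [[_ /qdim_fin nfin]|/qdim_fin dfin]; [left|right]; split=> //.
    by exists k2.
  by exists n2.
rewrite AE in nA kA.
have n4E := has_dim_uniq (@subspace_set0 _ X) nA nM.
have k4E := has_dim_uniq (subspace_image T (subspace_image_iter T (d + n) sM)) kA kM.
rewrite (fred_indexE sM F1) (fred_indexE sA F3).
subst n4 k4; congr EFin.
have := congr1 (fun m => m%:R : R) E1; have := congr1 (fun m => m%:R : R) E3.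
by rewrite !natrD; lra.
Qed.

End Invariants.

Theorem theorem2p21 (R : realType) (X : completeNormedModType R[i])
    (T : {linear X -> X})
    (dimX : vdim [set: X] = +oo%E) (contT : continuous T) :
  (bfredholm T setT <->
     exists M N : set X,
       [/\ Red T setT M N, fredholm T M, semi_regular T M
         & nilpotent_on T N])
  /\
  (forall M N : set X,
     Red T setT M N -> fredholm T M -> semi_regular T M -> nilpotent_on T N ->
     pseudo_bfredholm T setT /\
     [/\ alpha T setT = alpha T M,
         beta T setT = beta T M,
         pf_ascent T setT = pf_ascent T M,
         pf_descent T setT = pf_descent T M
       & pbf_index T setT = fred_index T M /\
         forall n : nat,
           closed (range (iter n T)) -> semi_fredholm T (range (iter n T)) ->
           fred_index T M = fred_index T (range (iter n T))]).
Proof.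
split.
  split=> [|[M [N [redMN fM srM nN]]]]; first exact: bfredholm_decomposition.
  exact: decomposition_bfredholm redMN fM srM nN.
move=> M N redMN fM srM nN; have [d Nd] := nN.
have [sM sN TM TN] := Red_sub redMN.
have sT := @subspace_setT _ X.
have qN := nilpotent_quasi_nilpotent contT sN TN nN.
have pair : pseudo_bfredholm_pair T setT M N by split.
split; first by exists M, N.
have redM : Red T M M [set 0].
  have cM : closed M by case: redMN => [[]].
  split; first by split.
  - split; [exact: closed_set0|exact: subspace_set0|by move=> _ ->; exact: subspace0|].
    by rewrite image_set1 linear0.
  - by apply/seteqP; split=> [x []//|_ ->]; split=> //; exact: subspace0.
  - by move=> x Mx; exists x, 0; rewrite addr0.
have n0 : nilpotent_on T [set 0] by exists 0%N.
have [aT bT pT qT] := pf_values contT sT redMN srM nN.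
have [aM bM pM qM] := pf_values contT sM redM srM n0.
split; rewrite ?aT ?bT ?pT ?qT//; split; last first.
  by move=> n _; exact: index_power_range redMN fM nN.
apply: xget_unique => [|_ [M' [N' [redMN' fM' qN']] <-]].
  by exists M => //; exists N.
exact: (index_decomposition_unique contT sT redMN srM Nd redMN' qN').
Qed.
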